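(* Let $\Omega\subseteq\mathbf{R}^d$ be a uniform domain with an Ahlfors $s$-regular boundary $\Gamma$, and let $\delta>2-(d-s)$. Assume that there are $r>0$ and $b_{\delta,r}>0$ such that $$\|d_\Gamma^{\,\delta/2}\,\nabla\psi\|_2\ \ge\ b_{\delta,r}\,\|d_\Gamma^{\,\delta/2-1}\psi\|_2$$ for all $\psi\in C_c^1(\Gamma_r)$. Then, since $s=d_H$ (the Hausdorff dimension of $\Gamma$), the boundary Hardy constant $b_\delta$ satisfies $$b_\delta\ \le\ (d-d_H+\delta-2)/2.$$
   Context: A domain is a connected open set. $d_\Gamma(x)$ is the Euclidean distance from $x$ to $\Gamma$, $\Gamma_r=\{x\in\Omega:d_\Gamma(x)<r\}$, $B(x;r)$ is the open Euclidean ball and $\|\cdot\|_2$ is the $L_2(\Omega)$-norm. Uniform domain: there is a $\sigma\ge1$ and for each pair of points $x,y\in\Omega$ a rectifiable curve $\gamma:[0,l]\to\Omega$, parametrized by arc length, with $\gamma(0)=x$, $\gamma(l)=y$, length $l\le\sigma|x-y|$ and $d_\Gamma(\gamma(t))\ge\sigma^{-1}\min(t,l-t)$ for all $t\in[0,l]$. (The paper only needs this property for all pairs $x,y$ in a boundary layer $\Gamma_r$, with the curve $\gamma$ in $\Omega$ but not constrained to $\Gamma_r$.) Ahlfors $s$-regular boundary: there is a regular Borel measure $\mu$ on $\Gamma$ and an $s>0$ such that for each subset $A=\Gamma\cap B(x_0;r_0)$, with $x_0\in\Gamma$ and $r_0>0$, one can choose $a>0$ so that $a^{-1}r^s\le\mu(A\cap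 B(x;r))\le a\,r^s$ for all $x\in A$ and $r\in(0,2r_0)$. Then $s$ equals the Hausdorff dimension $d_H$ of $\Gamma$. Boundary Hardy constant: $b_\delta$ is the supremum over $r>0$ of all possible $b_{\delta,r}$, i.e. $$b_\delta=\sup_{r>0}\ \inf_{0\ne\psi\in C_c^1(\Gamma_r)}\|d_\Gamma^{\,\delta/2}\nabla\psi\|_2\big/\|d_\Gamma^{\,\delta/2-1}\psi\|_2.$$ *)

(* Defs.v *)
From HB Require Import structures.
From mathcomp Require Import all_boot all_order all_algebra.
From mathcomp Require Import all_classical all_reals all_analysis.

Set Implicit Arguments.
Unset Strict Implicit.
Unset Printing Implicit Defensive.

Import Order.TTheory GRing.Theory Num.Theory.
Import numFieldNormedType.Exports.

Local Open Scope classical_set_scope.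
Local Open Scope ring_scope.

Section borel_matrix.
Variables (R : realType) (m n : nat).

HB.instance Definition _ := @isMeasurable.Build
  (sigma_display (@open 'M[R]_(m, n))) 'M[R]_(m, n) <<s @open 'M[R]_(m, n) >>
  (@sigma_algebra0 _ setT _) (@sigma_algebraC 'M[R]_(m, n) _)
  (@sigma_algebra_bigcup _ setT _).

End borel_matrix.

Section lebesgue_rV.
Variable R : realType.

Lemma measurable_fun_coord n (i : 'I_n) :
  measurable_fun [set: 'rV[R]_n] (fun v => v ord0 i).
Proof.
apply: (measurability _ (measurable_realfun.RGenOpens.measurableE R)).
move=> _ [_ [a [b ->] <-]]; rewrite setTI; apply: sub_sigma_algebra.
by move/continuousP: (@coord_continuous R 1 n ord0 i); apply; exact: interval_open.
Qed.

Lemma measurable_fun_rV d (T : measurableType d) n (f : T -> 'rV[R]_n) :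
  (forall i, measurable_fun [set: T] (fun t => f t ord0 i)) ->
  measurable_fun [set: T] f.
Proof.
move=> mf; apply: (measurability (@open 'rV[R]_n)) => //.
move=> _ [U oU <-]; rewrite setTI.
pose c (p : 'rV[rat]_n * rat) : set 'rV[R]_n :=
  [set v | 0 < ratr p.2 :> R /\
    forall i, `|ratr (p.1 ord0 i) - v ord0 i| < ratr p.2].
have -> : U = \bigcup_(p in [set p | c p `<=` U]) c p.
  apply/seteqP; split => [v Uv|v [p /= pU cv]]; last exact: pU.
  have /nbhs_ballP[e /= e0 veU] : nbhs v U by exact: open_nbhs_nbhs.
  have /rat_in_itvoo[q] : e / 4 < e / 2.
    by rewrite ltr_pM2l// ltf_pV2 ?posrE// ltr_nat.
  rewrite in_itv/= => /andP[eq qe].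
  have q0 : 0 < ratr q :> R by rewrite (lt_trans _ eq)// divr_gt0.
  have /choice[a av] (i : 'I_n) :
      exists a : rat, `|ratr a - v ord0 i| < ratr q.
    have /rat_in_itvoo[a] : v ord0 i - ratr q < v ord0 i + ratr q.
      by rewrite ltrD2l (lt_trans _ q0)// oppr_lt0.
    by rewrite in_itv/= -ltr_distl; exists a.
  exists (\row_i a i, q); last by split => //= i; rewrite mxE.
  move=> w /= [_ cw]; apply: veU; split => // i j.
  rewrite (ord1 i) /ball/= /ball_/= (splitr e).
  have := cw j; rewrite mxE => wj.
  rewrite -(subrKA (ratr (a j))) (le_lt_trans (ler_normD _ _))//.
  by rewrite ltrD// (lt_trans _ qe)// distrC.
rewrite preimage_bigcup bigcup_mkcond.
apply: countable_bigcupT_measurable => [|p]; first exact: countableP.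
case: ifPn => // _.
have -> : f @^-1` c p = [set _ | 0 < ratr p.2 :> R] `&`
    \big[setI/setT]_(i < n) ((fun t => f t ord0 i) @^-1`
      `](ratr (p.1 ord0 i) - ratr p.2), (ratr (p.1 ord0 i) + ratr p.2)[).
  apply/seteqP; split => t /= [p0 ft]; split=> //.
    elim/big_ind : _ => // i _ /=.
    by rewrite in_itv/= -ltr_distl distrC; exact: ft.
  move=> i; move: ft; rewrite (bigD1 i)//= => -[+ _].
  by rewrite in_itv/= -ltr_distl distrC.
apply: measurableI.
  have [p0|p0] := pselect (0 < ratr p.2 :> R).
    by rewrite (_ : mkset _ = setT)//; apply/seteqP; split.
  by rewrite (_ : mkset _ = set0)//; apply/seteqP; split.
apply: bigsetI_measurable => i _; rewrite -[X in measurable X]setTI.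
exact: mf.
Qed.

Definition rV_cons n (p : R * 'rV[R]_n) : 'rV[R]_n.+1 :=
  row_mx (p.1%:M : 'M[R]_1) p.2.

Lemma rV_cons0 n (p : R * 'rV[R]_n) : rV_cons p ord0 ord0 = p.1.
Proof.
have -> : @ord0 n = lshift n (@ord0 0) by exact: val_inj.
by rewrite [LHS](row_mxEl p.1%:M p.2 ord0 ord0) mxE eqxx mulr1n.
Qed.

Lemma rV_consS n (p : R * 'rV[R]_n) i :
  rV_cons p ord0 (lift ord0 i) = p.2 ord0 i.
Proof.
have -> : lift ord0 i = rshift 1 i by exact: val_inj.
exact: (row_mxEr (p.1%:M : 'M[R]_1) p.2 ord0 i).
Qed.

Lemma measurable_rV_cons n :
  measurable_fun setT (@rV_cons n : measurableTypeR R * 'rV[R]_n -> _).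
Proof.
apply: measurable_fun_rV => i; have [j|] := unliftP ord0 i => ->; last first.
  by under eq_fun do rewrite rV_cons0; exact: measurable_fst.
under eq_fun do rewrite rV_consS.
exact: (measurableT_comp (@measurable_fun_coord _ j) measurable_snd).
Qed.

Section step.
Variables (n : nat) (mu : {sigma_finite_measure set 'rV[R]_n -> \bar R}).

Let leb : {sigma_finite_measure set (measurableTypeR R) -> \bar R} :=
  @lebesgue_measure R.

Definition lebesgue_step : set 'rV[R]_n.+1 -> \bar R :=
  pushforward (leb \x mu)%E (@rV_cons n).

Let step0 : lebesgue_step set0 = 0%E.
Proof. by rewrite /lebesgue_step /pushforward preimage_set0 measure0. Qed.

Let step_ge0 A : (0 <= lebesgue_step A)%E.
Proof. exact: (measure_ge0 (leb \x mu)%E). Qed.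

Let step_sigma_additive : semi_sigma_additive lebesgue_step.
Proof.
move=> F mF tF mUF; rewrite /lebesgue_step /pushforward preimage_bigcup.
apply: (@measure_semi_sigma_additive _ _ _ (leb \x mu)%E).
- by move=> k; rewrite -[X in measurable X]setTI; exact: measurable_rV_cons.
- apply/trivIsetP => /= i j _ _ ij; rewrite -preimage_setI.
  by move/trivIsetP : tF => /(_ _ _ _ _ ij) ->//; rewrite preimage_set0.
- by rewrite -preimage_bigcup -[X in measurable X]setTI;
    exact: measurable_rV_cons.
Qed.

HB.instance Definition _ := isMeasure.Build _ _ _ lebesgue_step
  step0 step_ge0 step_sigma_additive.

Let step_sigma_finite : sigma_finite setT lebesgue_step.
Proof.
have [F FT Foo] : sigma_finite setT (leb \x mu)%E.
  have /sigma_finiteP[F [TF ndF Foo]] := sigma_finiteT leb.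
  have /sigma_finiteP[G [TG ndG Goo]] := sigma_finiteT mu.
  exists (fun k => F k `*` G k).
    rewrite -setXTT TF TG predeqE => -[x y]; split => [[/= [k _ Fx] [l _ Gy]]|].
      exists (maxn k l) => //; split => /=.
      + by move: x Fx; exact/subsetPset/ndF/leq_maxl.
      + by move: y Gy; exact/subsetPset/ndG/leq_maxr.
    by move=> [k _ []/= ? ?]; split; exists k.
  move=> k; have [? ?] := Foo k; have [? ?] := Goo k.
  split; first exact: measurableX.
  by rewrite product_measure1E// lte_mul_pinfty// ge0_fin_numE.
pose g (v : 'rV[R]_n.+1) : measurableTypeR R * 'rV[R]_n :=
  (v ord0 ord0, \row_i v ord0 (lift ord0 i)).
have gK p : g (rV_cons p) = p.
  case: p => x v; rewrite /g rV_cons0; congr pair.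
  by apply/rowP => i; rewrite mxE rV_consS.
have mg : measurable_fun setT g.
  apply: measurable_fun_pair; first exact: measurable_fun_coord.
  apply: measurable_fun_rV => i; under eq_fun do rewrite mxE.
  exact: measurable_fun_coord.
exists (fun k => g @^-1` F k).
  by rewrite -preimage_bigcup -FT preimage_setT.
move=> k; have [mFk Fkoo] := Foo k; split.
  by rewrite -[X in measurable X]setTI; exact: mg.
rewrite /lebesgue_step /pushforward (_ : _ @^-1` _ = F k)//.
by apply/seteqP; split => p /=; rewrite gK.
Qed.

HB.instance Definition _ :=
  Measure_isSigmaFinite.Build _ _ _ lebesgue_step step_sigma_finite.

End step.

(* Lebesgue measure on the Borel sets of R^n, as an n-fold product measure *)
Fixpoint lebesgue_rV n : {sigma_finite_measure set 'rV[R]_n -> \bar R} :=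
  if n is m.+1 then lebesgue_step (lebesgue_rV m) else \d_(0 : 'rV[R]_0).

Lemma measurable_box n (A : 'I_n -> set R) : (forall i, measurable (A i)) ->
  measurable [set v : 'rV[R]_n | forall i, A i (v ord0 i)].
Proof.
move=> mA; rewrite (_ : mkset _ =
    \big[setI/setT]_(i < n) ((fun v : 'rV[R]_n => v ord0 i) @^-1` A i)).
  apply: bigsetI_measurable => i _; rewrite -[X in measurable X]setTI.
  exact: measurable_fun_coord.
apply/seteqP; split => v /= Av;
  first by elim/big_ind : _ => // i _; exact: Av.
by move=> i; move: Av; rewrite (bigD1 i)//= => -[].
Qed.

Lemma lebesgue_rV_box n (A : 'I_n -> set R) : (forall i, measurable (A i)) ->
  lebesgue_rV n [set v | forall i, A i (v ord0 i)] =
  (\prod_(i < n) lebesgue_measure (A i))%E.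
Proof.
elim: n => [|n IHn] in A * => mA.
  by rewrite big_ord0 /= diracE mem_set// => -[].
rewrite big_ord_recl -(IHn (fun i => A (lift ord0 i)))//.
rewrite -product_measure1E; [|exact: mA|]; last first.
  by apply: (measurable_box (A := fun i => A (lift ord0 i))) => i; exact: mA.
apply: (congr1 (product_measure1 (@lebesgue_measure R) (lebesgue_rV n))).
apply/seteqP; split => -[x v] /=.
  move=> Av; split => [|i]; first by have := Av ord0; rewrite rV_cons0.
  by have := Av (lift ord0 i); rewrite rV_consS.
move=> [Ax Av] i; have [j|] := unliftP ord0 i => ->; first by rewrite rV_consS.
by rewrite rV_cons0.
Qed.

End lebesgue_rV.

Section euclidean.
Variables (R : realType) (n : nat).
Implicit Types (x y : 'rV[R]_n) (A Omega : set 'rV[R]_n).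

Definition eucl_norm x : R := Num.sqrt (\sum_(i < n) x ord0 i ^+ 2).

Definition eucl_ball x (r : R) : set 'rV[R]_n :=
  [set y | eucl_norm (y - x) < r].

(* meaningful for nonempty A only: inf set0 = 0 *)
Definition eucl_dist A x : R := inf [set eucl_norm (x - y) | y in A].

Definition eucl_diam A : \bar R :=
  ereal_sup (0%E |` [set (eucl_norm (p.1 - p.2))%:E | p in A `*` A]).

Definition boundary Omega : set 'rV[R]_n := closure Omega `\` interior Omega.

Definition domain Omega : Prop := open Omega /\ connected Omega.

Definition boundary_layer Omega (r : R) : set 'rV[R]_n :=
  [set x | Omega x /\ eucl_dist (boundary Omega) x < r].

Definition curve_length (gamma : R -> 'rV[R]_n) (a b : R) : \bar R :=
  ereal_sup [set (\sum_(0 <= k < size s)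
    eucl_norm (gamma (nth b (a :: s) k.+1) - gamma (nth b (a :: s) k)))%:E
    | s in itv_partition a b].

Definition arc_length_param (gamma : R -> 'rV[R]_n) (l : R) : Prop :=
  {within `[0, l], continuous gamma} /\
  forall a b, 0 <= a -> a <= b -> b <= l ->
    curve_length gamma a b = (b - a)%:E.

Definition uniform_domain Omega : Prop :=
  domain Omega /\
  exists2 sigma : R, 1 <= sigma &
    forall x y, Omega x -> Omega y ->
    exists (l : R) (gamma : R -> 'rV[R]_n),
      [/\ 0 <= l, arc_length_param gamma l, gamma 0 = x /\ gamma l = y,
          l <= sigma * eucl_norm (x - y) &
          forall t, 0 <= t <= l -> Omega (gamma t) /\
            sigma^-1 * Num.min t (l - t)
              <= eucl_dist (boundary Omega) (gamma t)].

Definition regular_borel_measure (mu : {measure set 'rV[R]_n -> \bar R}) :=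
  forall E, measurable E ->
    mu E = ereal_inf [set mu U | U in [set U | open U /\ E `<=` U]] /\
    mu E = ereal_sup [set mu K | K in [set K | compact K /\ K `<=` E]].

(* a Borel measure on the closed set Gamma is a Borel measure on R^n for which
   the complement of Gamma is a null set *)
Definition ahlfors_regular (Gamma : set 'rV[R]_n) (s : R) : Prop :=
  0 < s /\ exists mu : {measure set 'rV[R]_n -> \bar R},
    [/\ regular_borel_measure mu, mu (~` Gamma) = 0%E &
    forall x0 r0, Gamma x0 -> 0 < r0 ->
      let A := Gamma `&` eucl_ball x0 r0 in
      exists2 a : R, 0 < a & forall x r, A x -> 0 < r < 2 * r0 ->
        ((a^-1 * r `^ s)%:E <= mu (A `&` eucl_ball x r) <= (a * r `^ s)%:E)%E].

Definition hausdorff_premeasure (t eps : R) A : \bar R :=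
  ereal_inf [set (\sum_(0 <= k <oo) (eucl_diam (U k) `^ t))%E
    | U in [set U : (set 'rV[R]_n)^nat |
        A `<=` \bigcup_k U k /\ forall k, (eucl_diam (U k) <= eps%:E)%E]].

Definition hausdorff_measure (t : R) A : \bar R :=
  ereal_sup [set hausdorff_premeasure t eps A | eps in [set eps : R | 0 < eps]].

(* restricting to t > 0 avoids the convention for diam(U)^0 and does not affect
   the infimum *)
Definition hausdorff_dim A : \bar R :=
  ereal_inf [set t%:E | t in [set t : R | 0 < t /\ hausdorff_measure t A = 0%E]].

Definition partial (i : 'I_n) (psi : 'rV[R]_n -> R) x : R :=
  'D_(delta_mx ord0 i) psi x.

Definition grad (psi : 'rV[R]_n -> R) x : 'rV[R]_n := \row_i partial i psi x.

(* functions on U extended by zero to R^n *)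
Definition Cc1 (U : set 'rV[R]_n) : set ('rV[R]_n -> R) :=
  [set psi | [/\ forall x, differentiable psi x,
                 forall i, continuous (partial i psi),
                 compact (closure [set x | psi x != 0]) &
                 closure [set x | psi x != 0] `<=` U]].

Definition L2norm Omega (f : 'rV[R]_n -> R) : \bar R :=
  ('N[lebesgue_rV R n]_2%:E [EFin \o (f \_ Omega)])%E.

Definition weighted_grad_norm Omega (delta : R) (psi : 'rV[R]_n -> R) : \bar R :=
  L2norm Omega (fun x => eucl_norm
    (eucl_dist (boundary Omega) x `^ (delta / 2) *: grad psi x)).

Definition weighted_norm Omega (delta : R) (psi : 'rV[R]_n -> R) : \bar R :=
  L2norm Omega
    (fun x => eucl_dist (boundary Omega) x `^ (delta / 2 - 1) * psi x).

Definition layer_hardy_constant Omega (delta r : R) : \bar R :=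
  ereal_inf [set (weighted_grad_norm Omega delta psi
                  / weighted_norm Omega delta psi)%E
    | psi in [set psi | Cc1 (boundary_layer Omega r) psi
                        /\ psi <> (fun=> 0)]].

Definition hardy_constant Omega (delta : R) : \bar R :=
  ereal_sup [set layer_hardy_constant Omega delta r
    | r in [set r : R | 0 < r]].

End euclidean.

(* Main.v *)
Require Import Defs.
From mathcomp Require Import all_boot all_order all_algebra.
From mathcomp Require Import all_classical all_reals all_analysis.
From mathcomp Require Import measurable_realfun zify ring lra.

(* Let [al = (d - s + delta - 2) / 2]. Covering the boundary by [O(t^-s)] balls of radius [t]
   gives [dim_H <= s], so it suffices to bound the Hardy constant by [al], and it gives volume
   [O(t^(d - s))] for the layer [dist < t] in a ball around a boundary point. Conversely, near
   each point of a [t]-net of the boundary the uniform domain contains a ball of radius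
   comparable to [t] at distance comparable to [t] from the boundary, so the layer
   [dist ~ t] has volume at least [c t^(d - s)]. Hence each shell [dist ~ e^-k]
   contributes a quantity of order one to the integral of [dist^(delta - 2) dist^(-2 al)].
   Cutting [dist^-al] off to the shells [N <= k <= 3 N], with a cutoff of slope [O(1 / N)] in
   the variable [ln dist], changes the gradient energy by [O(N / N^2)], while the mass stays
   bounded below; letting [N] tend to infinity, the quotient is at most [al].
   The distance is not differentiable: it is replaced by a soft minimum of smoothed distances
   to the points of a finite net of the boundary, whose gradient is a convex combination of
   vectors of length at most [1 / dist] for [ln dist]. *)

Set Implicit Arguments.
Unset Strict Implicit.
Unset Printing Implicit Defensive.

Import Order.TTheory GRing.Theory Num.Theory.
Import numFieldNormedType.Exports.

Local Open Scope classical_set_scope.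
Local Open Scope ring_scope.

(** * Euclidean norm and distance *)

Section euclidean_norm.
Variables (R : realType) (n : nat).
Implicit Types (x y z v : 'rV[R]_n) (A : set 'rV[R]_n).

(** The exponent [al] is the borderline one: with [2 al = (d - s) + delta - 2] the integrand
    dist^(delta - 2 - 2 al) is dist^-(d - s), the reciprocal of the volume of a layer, which is why
    cutting off on a logarithmic scale is cheap. The hypothesis on [delta] says that [al] is
    positive, and replacing [s] by the smaller Hausdorff dimension only enlarges the bound. The
    obstacle is the sharp constant. A smooth function merely comparable to the distance would have a
    logarithm with gradient at most C / dist and lead to C al. The substitute [u] for ln dist must
    therefore satisfy |grad u| <= e^-u with constant exactly 1, and dist <= (1 + eta) e^u; all
    losses in the leading term are then powers of 1 + eta. The energy is compared with the mass M of
    the same test function, so M needs only a positive lower bound independent of [N], and the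
    middle shell of scale e^-(2 N) provides it. The parameters are chosen in the order eta, [N], and
    then a net of scale e^-(3 N) / 12, fine enough to resolve the innermost shell. *)

Lemma sum_sqr_ge0 x : 0 <= \sum_(i < n) x ord0 i ^+ 2.
Proof. by apply: sumr_ge0 => i _; exact: sqr_ge0. Qed.

Lemma eucl_norm_ge0 x : 0 <= eucl_norm x.
Proof. exact: sqrtr_ge0. Qed.

Lemma sqr_eucl_norm x : eucl_norm x ^+ 2 = \sum_(i < n) x ord0 i ^+ 2.
Proof. by rewrite sqr_sqrtr// sum_sqr_ge0. Qed.

Lemma eucl_norm0 : eucl_norm (0 : 'rV[R]_n) = 0.
Proof.
by rewrite /eucl_norm big1 ?sqrtr0// => i _; rewrite mxE expr0n.
Qed.

Lemma eucl_normZ a x : eucl_norm (a *: x) = `|a| * eucl_norm x.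
Proof.
rewrite /eucl_norm; under eq_bigr do rewrite mxE exprMn.
by rewrite -mulr_sumr sqrtrM ?sqr_ge0// sqrtr_sqr.
Qed.

Lemma eucl_normN x : eucl_norm (- x) = eucl_norm x.
Proof. by rewrite -scaleN1r eucl_normZ normrN1 mul1r. Qed.

Lemma eucl_distC x y : eucl_norm (x - y) = eucl_norm (y - x).
Proof. by rewrite -opprB eucl_normN. Qed.

Lemma ler_coord_eucl x i : `|x ord0 i| <= eucl_norm x.
Proof.
rewrite -(@ler_pXn2r _ 2) ?nnegrE ?eucl_norm_ge0// sqr_eucl_norm real_normK ?num_real//.
by rewrite (bigD1 i)//= lerDl sumr_ge0// => j _; exact: sqr_ge0.
Qed.

Lemma eucl_norm_le0 x : eucl_norm x <= 0 -> x = 0.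
Proof.
move=> x0; apply/rowP => i; rewrite mxE; apply/eqP.
by rewrite -normr_le0 (le_trans (ler_coord_eucl x i)).
Qed.

(* AM-GM with weights |y| and |x|, summed over the coordinates *)
Lemma cauchy_schwarz x y :
  \sum_(i < n) x ord0 i * y ord0 i <= eucl_norm x * eucl_norm y.
Proof.
have [x0|x0] := leP (eucl_norm x) 0.
  rewrite (eucl_norm_le0 x0) eucl_norm0 mul0r big1// => i _.
  by rewrite mxE mul0r.
have [y0|y0] := leP (eucl_norm y) 0.
  rewrite (eucl_norm_le0 y0) eucl_norm0 mulr0 big1// => i _.
  by rewrite mxE mulr0.
have xy0 : 0 < 2 * (eucl_norm x * eucl_norm y) by rewrite !mulr_gt0.
rewrite -(ler_pM2l xy0) mulr_sumr.
apply: (@le_trans _ _ (\sum_(i < n) (eucl_norm y ^+ 2 * x ord0 i ^+ 2 +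
    eucl_norm x ^+ 2 * y ord0 i ^+ 2))).
  apply: ler_sum => i _; rewrite -subr_ge0.
  rewrite (_ : _ - _ =
    (eucl_norm y * x ord0 i - eucl_norm x * y ord0 i) ^+ 2); first exact: sqr_ge0.
  by ring.
by rewrite big_split/= -!mulr_sumr -!sqr_eucl_norm le_eqVlt; apply/orP; left;
  apply/eqP; ring.
Qed.

Lemma ler_eucl_normD x y : eucl_norm (x + y) <= eucl_norm x + eucl_norm y.
Proof.
rewrite -(@ler_pXn2r _ 2) ?nnegrE ?addr_ge0 ?eucl_norm_ge0//.
rewrite sqrrD !sqr_eucl_norm.
under eq_bigr do rewrite mxE sqrrD.
rewrite !big_split/= lerD2r lerD2l mulr2n.
by apply: lerD; exact: cauchy_schwarz.
Qed.

Lemma eucl_norm_sum (I : Type) (r : seq I) (P : pred I) (F : I -> 'rV[R]_n) :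
  eucl_norm (\sum_(k <- r | P k) F k) <= \sum_(k <- r | P k) eucl_norm (F k).
Proof.
elim/big_ind2 : _ => [|a a' b b' aa' bb'|//]; first by rewrite eucl_norm0.
by rewrite (le_trans (ler_eucl_normD _ _))// lerD.
Qed.

Lemma ler_eucl_distD z x y :
  eucl_norm (x - y) <= eucl_norm (x - z) + eucl_norm (z - y).
Proof. by rewrite -(subrKA z) ler_eucl_normD. Qed.

Lemma eucl_norm_le_sum x : eucl_norm x <= \sum_(i < n) `|x ord0 i|.
Proof.
rewrite -(@ler_pXn2r _ 2) ?nnegrE ?eucl_norm_ge0 ?sumr_ge0//.
rewrite sqr_eucl_norm expr2 big_distrl/=.
apply: ler_sum => i _; rewrite -real_normK ?num_real// expr2 ler_wpM2l//.
by rewrite (bigD1 i)//= lerDl sumr_ge0.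
Qed.

Lemma eucl_norm_cube x t : (0 < n)%N ->
  (forall i, `|x ord0 i| < t / n%:R) -> eucl_norm x < t.
Proof.
move=> n0 xt; rewrite (le_lt_trans (eucl_norm_le_sum x))//.
apply: (@lt_le_trans _ _ (\sum_(i < n) t / n%:R)); last first.
  by rewrite sumr_const card_ord -[X in _ <= X](divfK (x := n%:R)) ?pnatr_eq0 -?lt0n// mulr_natr.
by apply: ltr_sum => [|i _]; [apply/hasP; exists (Ordinal n0); rewrite ?mem_index_enum|].
Qed.

Lemma norm_le_eucl_norm x : `|x| <= eucl_norm x.
Proof.
rewrite [leLHS]mx_normrE; apply: bigmax_le; first exact: eucl_norm_ge0.
by move=> [i j] _ /=; rewrite (ord1 i) ler_coord_eucl.
Qed.

Lemma lipschitz_continuous (f : 'rV[R]_n -> R) :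
  (forall x y, `|f x - f y| <= eucl_norm (x - y)) -> continuous f.
Proof.
move=> fL x s /= /(nbhs_ballP (f x)) [e /= e0 es].
(* The neighbourhoods are those of the sup norm, so a Euclidean distance may be [n] times the
   radius; the divisor [n + 1] makes the bound strict and covers [n = 0]. *)
have n1 : 0 < n%:R + 1 :> R by rewrite ltr_wpDl.
apply/nbhs_ballP; exists (e / (n%:R + 1)) => /=; first exact: divr_gt0.
move=> y [_ xy]; apply: es; rewrite /ball/= (le_lt_trans (fL x y))//.
rewrite (le_lt_trans (eucl_norm_le_sum _))//.
apply: (@le_lt_trans _ _ (\sum_(i < n) e / (n%:R + 1))).
  by apply: ler_sum => i _; rewrite !mxE ltW//; exact: (xy ord0 i).
by rewrite sumr_const card_ord -[ltLHS]mulr_natr -mulrA gtr_pMr// mulrC ltr_pdivrMr//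
  mul1r ltrDl.
Qed.

Lemma eucl_norm_lipschitz x y : `|eucl_norm x - eucl_norm y| <= eucl_norm (x - y).
Proof.
rewrite ler_norml; apply/andP; split.
  rewrite lerNl opprB lerBlDr eucl_distC.
  by rewrite -[X in eucl_norm X <= _](subrK x) ler_eucl_normD.
by rewrite lerBlDr -[X in eucl_norm X <= _](subrK y) ler_eucl_normD.
Qed.

Lemma continuous_eucl_dist_pt y : continuous (fun x => eucl_norm (x - y)).
Proof.
apply: lipschitz_continuous => x z.
by rewrite (le_trans (eucl_norm_lipschitz _ _))// opprB addrA subrK.
Qed.

Lemma open_eucl_ball x t : open (eucl_ball x t).
Proof.
rewrite (_ : eucl_ball x t = (fun y => eucl_norm (y - x)) @^-1` [set u | u < t])//.
by apply: open_comp; [move=> y _; exact: continuous_eucl_dist_pt|exact: open_lt].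
Qed.

Lemma eucl_ball_center x t : 0 < t -> eucl_ball x t x.
Proof. by move=> t0; rewrite /eucl_ball/= subrr eucl_norm0. Qed.

Lemma has_inf_eucl_dist A x : A !=set0 -> has_inf [set eucl_norm (x - y) | y in A].
Proof.
move=> [y Ay]; split; first by exists (eucl_norm (x - y)), y.
by exists 0 => _ [z _ <-]; exact: eucl_norm_ge0.
Qed.

Lemma eucl_dist_le A x y : A y -> eucl_dist A x <= eucl_norm (x - y).
Proof.
move=> Ay; apply: ge_inf; last by exists y.
by exists 0 => _ [z _ <-]; exact: eucl_norm_ge0.
Qed.

Lemma eucl_dist_ge0 A x : A !=set0 -> 0 <= eucl_dist A x.
Proof.
move=> [y Ay]; apply: lb_le_inf; first by exists (eucl_norm (x - y)), y.
by move=> _ [z _ <-]; exact: eucl_norm_ge0.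
Qed.

Lemma eucl_dist_adherent A x e : A !=set0 -> 0 < e ->
  exists2 y, A y & eucl_norm (x - y) < eucl_dist A x + e.
Proof.
move=> A0 e0; have [_ [y Ay <-] xy] := inf_adherent e0 (has_inf_eucl_dist x A0).
by exists y.
Qed.

Lemma eucl_dist_lipschitz A x y : A !=set0 ->
  `|eucl_dist A x - eucl_dist A y| <= eucl_norm (x - y).
Proof.
move=> A0.
have H u v : eucl_dist A u - eucl_dist A v <= eucl_norm (u - v).
  apply/ler_addgt0Pl => e e0.
  have [z Az vz] := eucl_dist_adherent v A0 e0.
  rewrite lerBlDr (le_trans (eucl_dist_le u Az))//.
  rewrite (le_trans (ler_eucl_distD v u z))//.
  by move: vz; lra.
by rewrite ler_norml H andbT lerNl opprB eucl_distC H.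
Qed.

Lemma continuous_eucl_dist A : A !=set0 -> continuous (eucl_dist A).
Proof.
by move=> A0; apply: lipschitz_continuous => x y; exact: eucl_dist_lipschitz.
Qed.

Lemma eucl_dist0 A x : A x -> eucl_dist A x = 0.
Proof.
move=> Ax; apply/eqP; rewrite eq_le eucl_dist_ge0 ?andbT; last by exists x.
by rewrite (le_trans (eucl_dist_le x Ax))// subrr eucl_norm0.
Qed.

End euclidean_norm.

(** * Gradients of C1 functions and soft minima *)

Section gradients.
Variables (R : realType) (n : nat).
Implicit Types (f : 'rV[R]_n -> R) (g : 'rV[R]_n -> 'rV[R]_n).

(** The gradient is carried as an explicit function, so that the rules of calculus produce a formula
    to estimate along with the regularity required by [Cc1]. *)
Definition has_cgrad f g :=
  [/\ forall x, differentiable f x, forall x, grad f x = g x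
    & forall i, continuous (fun x => g x ord0 i)].

Lemma has_cgrad_diff f g x i : has_cgrad f g ->
  'd f x (delta_mx ord0 i) = g x ord0 i.
Proof. by move=> [df <- _]; rewrite mxE /partial deriveE. Qed.

Lemma has_cgrad_intro f g :
  (forall x, differentiable f x) ->
  (forall x i, 'd f x (delta_mx ord0 i) = g x ord0 i) ->
  (forall i, continuous (fun x => g x ord0 i)) -> has_cgrad f g.
Proof.
move=> df dfg cg; split=> // x; apply/rowP => i.
by rewrite mxE /partial deriveE.
Qed.

Lemma eq_has_cgrad f g f' g' : f =1 f' -> g =1 g' ->
  has_cgrad f g -> has_cgrad f' g'.
Proof. by move=> /funext -> /funext ->. Qed.

Lemma has_cgrad_continuous f g : has_cgrad f g -> continuous f.
Proof. by move=> [df _ _] x; exact: differentiable_continuous. Qed.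

Lemma has_cgrad_cst (c : R) : has_cgrad (fun=> c) (fun=> 0).
Proof.
apply: has_cgrad_intro => [x|x i|i x]; first exact: differentiable_cst.
  by rewrite diff_cst mxE.
exact: cst_continuous.
Qed.

Lemma has_cgrad_coord i : has_cgrad (fun x => x ord0 i) (fun=> delta_mx ord0 i).
Proof.
split=> [x|x|j x]; last exact: cst_continuous.
  exact: differentiable_coord.
apply/rowP => j; rewrite mxE /partial /derive; apply: cvg_lim => //=.
apply: (@cvg_trans _ ((fun=> (delta_mx ord0 i : 'rV[R]_n) ord0 j : R) @ 0^'));
  last exact: cvg_cst.
apply: near_eq_cvg; near=> h.
have h0 : h != 0 by near: h; exact: nbhs_dnbhs_neq.
rewrite !mxE/= addrK /GRing.scale/= mulrA mulVf// mul1r.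
by rewrite eq_sym.
Unshelve. all: by end_near. Qed.

Lemma has_cgradD f g f' g' : has_cgrad f g -> has_cgrad f' g' ->
  has_cgrad (fun x => f x + f' x) (fun x => g x + g' x).
Proof.
move=> fg fg'; have [df _ cg] := fg; have [df' _ cg'] := fg'.
apply: has_cgrad_intro => [x|x i|i x]; first exact: differentiableD.
  by rewrite mxE -(has_cgrad_diff x i fg) -(has_cgrad_diff x i fg') diffD.
rewrite (_ : (fun x => _) = fun x => g x ord0 i + g' x ord0 i).
  by apply: continuousD; [exact: cg|exact: cg'].
by apply/funext => y; rewrite mxE.
Qed.

Lemma has_cgradM f g f' g' : has_cgrad f g -> has_cgrad f' g' ->
  has_cgrad (fun x => f x * f' x) (fun x => f x *: g' x + f' x *: g x).
Proof.
move=> fg fg'; have [df _ cg] := fg; have [df' _ cg'] := fg'.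
apply: has_cgrad_intro => [x|x i|i x]; first exact: differentiableM.
  by rewrite !mxE -(has_cgrad_diff x i fg) -(has_cgrad_diff x i fg') diffM.
rewrite (_ : (fun x => _) = fun x => f x * g' x ord0 i + f' x * g x ord0 i).
  have cf := @has_cgrad_continuous _ _ fg x.
  have cf' := @has_cgrad_continuous _ _ fg' x.
  exact: (continuousD (continuousM cf (cg' i x)) (continuousM cf' (cg i x))).
by apply/funext => y; rewrite !mxE.
Qed.

Lemma has_cgrad_sum (I : Type) (r : seq I) (F : I -> 'rV[R]_n -> R) G :
  (forall k, has_cgrad (F k) (G k)) ->
  has_cgrad (fun x => \sum_(k <- r) F k x) (fun x => \sum_(k <- r) G k x).
Proof.
move=> FG; elim: r => [|k r IH].
  under eq_fun do rewrite big_nil; under [X in has_cgrad _ X]eq_fun do rewrite big_nil.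
  exact: has_cgrad_cst.
under eq_fun do rewrite big_cons; under [X in has_cgrad _ X]eq_fun do rewrite big_cons.
exact: has_cgradD.
Qed.

Lemma has_cgrad_comp (phi dphi : R -> R) f g :
  has_cgrad f g -> (forall x, is_derive (f x) (1 : R) phi (dphi (f x))) ->
  (forall x, {for f x, continuous dphi}) ->
  has_cgrad (fun x => phi (f x)) (fun x => dphi (f x) *: g x).
Proof.
move=> fg dphiP cdphi; have [df _ cg] := fg.
have dp x : differentiable phi (f x).
  by apply/derivable1_diffP; have [] := dphiP x.
apply: has_cgrad_intro => [x|x i|i x]; first exact: differentiable_comp.
  rewrite mxE -(has_cgrad_diff x i fg) (_ : (fun x => phi (f x)) = phi \o f)//.
  rewrite diff_comp//= diff1E// derive1E.
  by have [_ ->] := dphiP x; rewrite /GRing.scale/= mulrC.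
rewrite (_ : (fun x => _) = fun x => dphi (f x) * g x ord0 i).
  have cf := @has_cgrad_continuous _ _ fg x.
  exact: (continuousM (continuous_comp cf (cdphi x)) (cg i x)).
by apply/funext => y; rewrite mxE.
Qed.

Lemma has_cgrad_sqr_dist y :
  has_cgrad (fun x => eucl_norm (x - y) ^+ 2) (fun x => 2 *: (x - y)).
Proof.
have H i : has_cgrad (fun x => (x ord0 i - y ord0 i) ^+ 2)
    (fun x => (2 * (x ord0 i - y ord0 i)) *: delta_mx ord0 i).
  have h := has_cgradD (has_cgrad_coord i) (has_cgrad_cst (- y ord0 i)).
  apply: eq_has_cgrad (has_cgradM h h) => x; first by rewrite expr2.
  by rewrite addr0 -scalerDl mulr_natl mulr2n.
apply: eq_has_cgrad (has_cgrad_sum (index_enum 'I_n) H) => x.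
  rewrite sqr_eucl_norm; apply: eq_bigr => i _.
  by rewrite !mxE.
apply/rowP => j; rewrite !mxE summxE (bigD1 j)//=.
rewrite big1 ?addr0 => [|i ij]; rewrite !mxE ?eqxx ?mulr1//.
by rewrite eq_sym (negbTE ij) andbF mulr0.
Qed.

End gradients.

(* a [C^1] cutoff vanishing exactly on the negative half-line *)
Definition sqr_pos (R : realType) (t : R) : R := Num.max 0 t ^+ 2.

Section sqr_pos.
Variable R : realType.
Implicit Types t : R.

Lemma is_derive_sqr_pos t :
  is_derive t (1 : R) (@sqr_pos R) (2 * Num.max 0 t).
Proof.
(* A quadratic bound on the Taylor remainder, checked for each pair of signs, also covers [t = 0],
   where the two branches meet. *)
have bnd h : `|sqr_pos (h + t) - sqr_pos t - 2 * Num.max 0 t * h| <= h ^+ 2.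
  rewrite /sqr_pos ler_norml; have [t0|t0] := leP 0 t; have [ht|ht] := leP 0 (h + t).
  - by apply/andP; split; nra.
  - by apply/andP; split; nra.
  - by apply/andP; split; nra.
  - by apply/andP; split; nra.
suff cvgh : h^-1 *: (sqr_pos (h *: (1 : R) + t) - sqr_pos t) @[h --> 0^'] -->
    2 * Num.max 0 t.
  by apply: DeriveDef; [apply/cvg_ex; eexists; exact: cvgh|exact: cvg_lim cvgh].
apply/cvgrPdist_lt => e e0; near=> h.
have h0 : h != 0 by near: h; exact: nbhs_dnbhs_neq.
rewrite /GRing.scale/= mulr1.
have -> : 2 * Num.max 0 t - h^-1 * (sqr_pos (h + t) - sqr_pos t) =
    - (h^-1 * (sqr_pos (h + t) - sqr_pos t - 2 * Num.max 0 t * h)).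
  by field.
rewrite normrN normrM normfV -ltr_pdivlMl ?invr_gt0 ?normr_gt0// invrK.
rewrite (le_lt_trans (bnd h))// -real_normK ?num_real// expr2 ltr_pM2l ?normr_gt0//.
near: h; apply: dnbhs0_lt => //.
Unshelve. all: by end_near. Qed.

Lemma continuous_sqr_pos_derivative : continuous (fun t : R => 2 * Num.max 0 t).
Proof.
move=> t; apply: (@continuousM _ _ (cst 2) (fun t => Num.max 0 t)).
  exact: cst_continuous.
by apply: (@continuous_max _ _ (cst 0) id); [exact: cst_continuous|exact: cvg_id].
Qed.

End sqr_pos.

Section softmin.
Variables (R : realType) (n : nat).
Implicit Types (x y : 'rV[R]_n).

Lemma has_cgrad_scale (c : R) f (g : 'rV[R]_n -> 'rV[R]_n) : has_cgrad f g ->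
  has_cgrad (fun x => c * f x) (fun x => c *: g x).
Proof.
move=> fg; apply: eq_has_cgrad (has_cgradM (has_cgrad_cst n c) fg) => // x.
by rewrite scaler0 addr0.
Qed.

Lemma has_cgrad_expR f (g : 'rV[R]_n -> 'rV[R]_n) : has_cgrad f g ->
  has_cgrad (fun x => expR (f x)) (fun x => expR (f x) *: g x).
Proof.
move=> fg; apply: (has_cgrad_comp (dphi := expR)) fg _ _ => x.
exact: continuous_expR.
Qed.

Lemma has_cgrad_ln f (g : 'rV[R]_n -> 'rV[R]_n) : has_cgrad f g ->
  (forall x, 0 < f x) ->
  has_cgrad (fun x => ln (f x)) (fun x => (f x)^-1 *: g x).
Proof.
move=> fg f0; apply: (has_cgrad_comp (dphi := GRing.inv)) fg _ _ => x.
  exact: is_derive1_ln.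
by apply: inv_continuous; rewrite gt_eqF.
Qed.

Lemma has_cgrad_sqr_pos f (g : 'rV[R]_n -> 'rV[R]_n) : has_cgrad f g ->
  has_cgrad (fun x => sqr_pos (f x)) (fun x => (2 * Num.max 0 (f x)) *: g x).
Proof.
move=> fg; apply: (has_cgrad_comp (dphi := fun t => 2 * Num.max 0 t)) fg _ _ => x.
  exact: is_derive_sqr_pos.
exact: continuous_sqr_pos_derivative.
Qed.

Section log_sum_exp.
Variables (I : eqType) (F : seq I) (v : I -> 'rV[R]_n -> R).
Variables (dv : I -> 'rV[R]_n -> 'rV[R]_n) (lam : R).
Hypotheses (F0 : F != [::]) (lam0 : 0 < lam).
Hypothesis v_cgrad : forall k, has_cgrad (v k) (dv k).

Let G x := \sum_(k <- F) expR (- lam * v k x).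
Definition softmin x := - lam^-1 * ln (\sum_(k <- F) expR (- lam * v k x)).
Definition softmin_grad x :=
  \sum_(k <- F) (expR (- lam * v k x) / G x) *: dv k x.

Let G_gt0 x : 0 < G x.
Proof.
rewrite /G; case: F F0 => // k r _.
by rewrite big_cons ltr_wpDr ?expR_gt0// sumr_ge0// => i _; exact: expR_ge0.
Qed.

Lemma has_cgrad_softmin : has_cgrad softmin softmin_grad.
Proof.
apply: eq_has_cgrad (has_cgrad_scale (- lam^-1) (has_cgrad_ln
  (has_cgrad_sum F (fun k => has_cgrad_expR (has_cgrad_scale (- lam) (v_cgrad k))))
  G_gt0)) => // x.
rewrite scalerA scaler_sumr; apply: eq_bigr => k _.
rewrite !scalerA /G; congr (_ *: _).
by field; rewrite !gt_eqF// G_gt0.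
Qed.

Lemma expR_softmin x : expR (- lam * softmin x) = G x.
Proof.
rewrite /softmin mulrA mulrNN divff ?gt_eqF// mul1r lnK//.
by rewrite posrE G_gt0.
Qed.

Lemma softmin_le x k : k \in F -> softmin x <= v k x.
Proof.
move=> kF; rewrite -(ler_nM2l (x := - lam)) ?oppr_lt0// -ler_expR expR_softmin.
rewrite /G (big_rem k)//= lerDl sumr_ge0// => i _; exact: expR_ge0.
Qed.

(** The weights are nonnegative with sum one, and [softmin] lies below every [v k], so each bound
    [expR (- v k x)] may be replaced by the larger [expR (- softmin x)]: no constant is lost. *)
Lemma softmin_grad_le x : (forall k, eucl_norm (dv k x) <= expR (- v k x)) ->
  eucl_norm (softmin_grad x) <= expR (- softmin x).
Proof.
move=> dv_le; rewrite (le_trans (eucl_norm_sum _ _ _))//.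
apply: (@le_trans _ _ (\sum_(k <- F) expR (- lam * v k x) / G x * expR (- softmin x))).
  rewrite big_seq [leRHS]big_seq; apply: ler_sum => k kF; rewrite eucl_normZ.
  have w0 : 0 <= expR (- lam * v k x) / G x.
    by rewrite divr_ge0 ?expR_ge0// ltW.
  rewrite ger0_norm// ler_wpM2l// (le_trans (dv_le k))//.
  by rewrite ler_expR lerN2 softmin_le.
by rewrite -!mulr_suml divff ?mul1r// gt_eqF//; exact: G_gt0.
Qed.

(** If every [v k x] exceeded [softmin x + c], each of the [size F] terms of [G x] would be at most
    [G x * expR (- lam * c)], and their sum would be less than [G x]. *)
Lemma softmin_ge x c : (size F)%:R < expR (lam * c) ->
  exists2 k, k \in F & v k x <= softmin x + c.
Proof.
move=> Fc; apply: contrapT => H.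
have vk k : k \in F -> softmin x + c < v k x.
  by move=> kF; rewrite ltNge; apply/negP => ?; apply: H; exists k.
suff : G x < G x by rewrite ltxx.
rewrite {1}/G big_seq.
apply: (@le_lt_trans _ _ (\sum_(k <- F | k \in F) expR (- lam * (softmin x + c)))).
  by apply: ler_sum => k kF; rewrite ler_expR ler_nM2l ?oppr_lt0// ltW// vk.
rewrite -big_seq big_const_seq count_predT iter_addr_0 -mulr_natl.
rewrite mulrDr expRD expR_softmin mulrCA gtr_pMr// mulNr expRN.
by rewrite ltr_pdivrMr ?expR_gt0// mul1r.
Qed.

End log_sum_exp.

Lemma softmin_dist (F : seq 'rV[R]_n) (eps eta : R) :
  F != [::] -> 0 < eps -> 0 < eta ->
  exists (u : 'rV[R]_n -> R) (g : 'rV[R]_n -> 'rV[R]_n),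
  [/\ has_cgrad u g, forall x, eucl_norm (g x) <= expR (- u x),
      forall x y, y \in F -> expR (u x) <= eucl_norm (x - y) + eps
    & forall x, exists2 y, y \in F & eucl_norm (x - y) <= (1 + eta) * expR (u x)].
Proof.
move=> F0 eps0 eta0.
(* Adding [eps ^+ 2] removes the singularity at [y]. The logarithm [v y] of the square root of [q y]
   has a gradient of length |x - y| / q, at most the inverse of that square root. *)
pose q y x := eucl_norm (x - y) ^+ 2 + eps ^+ 2.
have q0 y x : 0 < q y x by rewrite ltr_wpDl ?sqr_ge0// exprn_gt0.
pose v y x := 2^-1 * ln (q y x).
pose dv y x := (q y x)^-1 *: (x - y).
have v_cgrad y : has_cgrad (v y) (dv y).
  apply: eq_has_cgrad (has_cgrad_scale 2^-1 (has_cgrad_ln (has_cgradD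
    (has_cgrad_sqr_dist y) (has_cgrad_cst n (eps ^+ 2))) (q0 y))) => // x.
  rewrite addr0 !scalerA; congr (_ *: _); rewrite -/(q y x).
  by field; rewrite gt_eqF.
have sqr_v y x : expR (v y x) ^+ 2 = q y x.
  by rewrite -expRM_natl /v mulrA mulfV// mul1r lnK// posrE.
have v_le y x : expR (v y x) <= eucl_norm (x - y) + eps.
  rewrite -(@ler_pXn2r _ 2) ?nnegrE ?expR_ge0//; last first.
    by rewrite addr_ge0 ?eucl_norm_ge0// ltW.
  rewrite sqr_v sqrrD lerD2r lerDl mulrn_wge0// mulr_ge0 ?eucl_norm_ge0//.
  exact: ltW.
have v_ge y x : eucl_norm (x - y) <= expR (v y x).
  rewrite -(@ler_pXn2r _ 2) ?nnegrE ?expR_ge0 ?eucl_norm_ge0//.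
  by rewrite sqr_v lerDl sqr_ge0.
have dv_le y x : eucl_norm (dv y x) <= expR (- v y x).
  rewrite eucl_normZ gtr0_norm ?invr_gt0// -sqr_v expRN.
  rewrite expr2 invfM -mulrA ger_pMr ?invr_gt0 ?expR_gt0//.
  by rewrite mulrC ler_pdivrMr ?expR_gt0// mul1r.
(* With this [lam], [expR (lam * ln (1 + eta))] is the exponential of [size F + 1], larger than
   [size F] as [softmin_ge] demands. *)
pose lam := (size F).+1%:R / ln (1 + eta).
have lneta : 0 < ln (1 + eta) by rewrite ln_gt0// ltrDl.
have lam0 : 0 < lam by rewrite divr_gt0.
exists (softmin F v lam), (softmin_grad F v dv lam); split.
- exact: has_cgrad_softmin.
- by move=> x; apply: softmin_grad_le.
- move=> x y yF; rewrite (le_trans _ (v_le y x))// ler_expR.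
  exact: softmin_le.
- move=> x; have [|y yF vy] := @softmin_ge _ F v lam F0 lam0 x (ln (1 + eta)).
    rewrite /lam divfK ?gt_eqF//.
    rewrite (lt_le_trans _ (expR_ge1Dx _))// ltr_wpDl// ltr_nat//.
  exists y => //; rewrite (le_trans (v_ge y x))// mulrC.
  rewrite -[X in _ * X]lnK ?posrE ?addr_gt0//.
  by rewrite -expRD ler_expR.
Qed.

End softmin.

(** * Extension by zero from an open set *)

Section restriction_to_open.
Variables (R : realType) (n : nat).
Implicit Types (f : 'rV[R]_n -> R) (g : 'rV[R]_n -> 'rV[R]_n).

Lemma near_eq_differentiable f f' x : {near x, f =1 f'} ->
  differentiable f x -> differentiable f' x.
Proof.
move=> ff' df; have ffx := nbhs_singleton ff'.
have ff0 : \forall h \near (0 : 'rV[R]_n), f (h + x) = f' (h + x).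
  by move: (ff' : \forall y \near x, f y = f' y); rewrite (near_shift 0) subr0.
have E : f' \o shift x = cst (f' x) + 'd f x +o_ 0 id.
  apply/eqaddoP => e e0; have /eqaddoP/(_ e e0) := diff_locally df.
  apply: filter_app; near=> h.
  rewrite /= !fctE -ffx (_ : f' (h + x) = f (h + x))//; symmetry.
  by near: h.
apply/diff_locallyP.
have -> : 'd f' x = 'd f x :> (_ -> _) by apply: diff_unique => //; exact: diff_continuous.
by split; [exact: diff_continuous|].
Unshelve. all: by end_near. Qed.

Lemma near_eq_continuous f f' x : {near x, f =1 f'} ->
  {for x, continuous f} -> {for x, continuous f'}.
Proof.
move=> ff' cf; have e := nbhs_singleton ff'.
have cf' : f y @[y --> x] --> f' x by rewrite -e.
exact: cvg_trans (near_eq_cvg ff') cf'.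
Qed.

Lemma near_eq_has_cgrad f g (f' : 'rV[R]_n -> R) g' x :
  has_cgrad f g -> {near x, f =1 f'} -> {near x, g =1 g'} ->
  [/\ differentiable f' x, grad f' x = g' x
    & forall i, {for x, continuous (fun y => g' y ord0 i)}].
Proof.
move=> [df dfg cg] ff' gg'; split.
- exact: near_eq_differentiable (df x).
- rewrite -(nbhs_singleton gg') -dfg; apply/rowP => i; rewrite !mxE /partial.
  by apply: near_eq_derive; apply: filterS ff' => y ->.
- move=> i; apply: near_eq_continuous (cg i x).
  by apply: filterS gg' => y ->.
Qed.

(** The open set [U] and the open complement of the closure of [S] cover the space: on the first the
    product is [f], on the second it vanishes. Differentiability is local, so nothing happens at the
    boundary of [U], although [f] need not vanish outside [U]. *)
Lemma has_cgrad_restrict f g (U : set 'rV[R]_n) : has_cgrad f g -> open U ->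
  closure (U `&` [set x | f x != 0]) `<=` U ->
  has_cgrad (fun x => \1_U x * f x) (fun x => \1_U x *: g x).
Proof.
move=> fg oU sU; set S := U `&` _ in sU; have [df dfg cg] := fg.
have H x : [/\ differentiable (fun x => \1_U x * f x) x,
     grad (fun x => \1_U x * f x) x = \1_U x *: g x
    & forall i, {for x, continuous (fun y => (\1_U y *: g y) ord0 i)}].
  have [Ux|Ux] := pselect (U x).
    apply: (near_eq_has_cgrad (f := f) (g := g)) => //.
      apply: filterS (open_nbhs_nbhs (conj oU Ux)) => y Uy.
      by rewrite indicE mem_set// mul1r.
    apply: filterS (open_nbhs_nbhs (conj oU Ux)) => y Uy.
    by rewrite indicE mem_set// scale1r.
  have oV : open (~` closure S) by apply: closed_openC; exact: closed_closure.
  have Vx : (~` closure S) x by move=> /sU.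
  have V0 y : (~` closure S) y -> U y -> f y = 0.
    by move=> Vy Uy; apply: contrapT => /eqP fy; apply: Vy; exact: subset_closure.
  apply: (near_eq_has_cgrad (has_cgrad_cst n 0)).
    apply: filterS (open_nbhs_nbhs (conj oV Vx)) => y Vy.
    rewrite indicE; have [Uy|Uy] := boolP (y \in U); last by rewrite mul0r.
    by rewrite (V0 y Vy (set_mem Uy)) mulr0.
  apply: filterS (open_nbhs_nbhs (conj oV Vx)) => y Vy.
  rewrite indicE; have [/set_mem Uy|Uy] := boolP (y \in U); last by rewrite scale0r.
  (* Here [f] vanishes in a neighbourhood of [y], so its gradient vanishes at [y]. *)
  rewrite scale1r -dfg; apply/rowP => i; rewrite !mxE /partial.
  rewrite -(near_eq_derive (f := fun=> 0)) ?derive_cst//.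
  have oVU := openI oV oU.
  by apply: filterS (open_nbhs_nbhs (conj oVU (conj Vy Uy))) => z [Vz Uz]; rewrite V0.
by split=> [x|x|i x]; have [h1 h2 h3] := H x => //; exact: h3.
Qed.

End restriction_to_open.

(** * Interior points of uniform domains *)

Section domains.
Variables (R : realType) (n : nat).
Implicit Types (x y z : 'rV[R]_n) (Omega : set 'rV[R]_n).

Lemma boundary_open Omega : open Omega -> boundary Omega = closure Omega `\` Omega.
Proof. by rewrite /boundary => /interior_id ->. Qed.

Lemma closed_boundary Omega : closed (boundary Omega).
Proof.
rewrite /boundary setDE; apply: closedI; first exact: closed_closure.
by apply: open_closedC; exact: open_interior.
Qed.

Lemma dist_boundary_in Omega x : open Omega -> closure Omega x ->
  0 < eucl_dist (boundary Omega) x -> Omega x.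
Proof.
move=> oO cOx dx; apply: contrapT => Ox; move: dx.
by rewrite eucl_dist0 ?ltxx// boundary_open.
Qed.

(** The segment from [z] to [x] is too short to meet the boundary, so [Omega] is open and closed
    relative to this connected set and contains all of it. *)
Lemma eucl_ball_sub_domain Omega x z : open Omega -> Omega z ->
  eucl_norm (x - z) < eucl_dist (boundary Omega) z -> Omega x.
Proof.
move=> oO Oz xz.
pose c (t : R) := z + t *: (x - z).
have cc : continuous c.
  by move=> t; apply: cvgD; [exact: cvg_cst|exact: scalel_continuous].
pose S := c @` `[0, 1].
have Sconn : connected S.
  apply: connected_continuous_connected; first exact: segment_connected.
  exact: continuous_subspaceT.
have Sz : S z by exists 0; rewrite /c ?scale0r ?addr0//= in_itv/= lexx ler01.
have Sx : S x.
  exists 1; first by rewrite /= in_itv/= lexx ler01.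
  by rewrite /c scale1r addrC subrK.
have Snb y : S y -> ~ boundary Omega y.
  move=> [t /=]; rewrite in_itv/= => /andP[t0 t1] <- By.
  move: xz; apply/negP; rewrite -leNgt (le_trans (eucl_dist_le z By))//.
  rewrite /c opprD addNKr eucl_normN eucl_normZ ger0_norm//.
  by rewrite ler_piMl// eucl_norm_ge0.
suff SO : S `&` Omega = S by move: Sx; rewrite -SO => -[].
apply: Sconn; first by exists z.
  by exists Omega.
exists (closure Omega); first exact: closed_closure.
apply/seteqP; split => y [Sy Oy]; split => //; first exact: subset_closure.
by apply: contrapT => nOy; apply: (Snb _ Sy); rewrite boundary_open.
Qed.

Lemma arc_length_chord (gamma : R -> 'rV[R]_n) l a b : arc_length_param gamma l ->
  0 <= a -> a < b -> b <= l -> eucl_norm (gamma b - gamma a) <= b - a.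
Proof.
move=> [_ gl] a0 ab bl; rewrite -lee_fin -(gl _ _ a0 (ltW ab) bl).
apply: ereal_sup_ubound; exists [:: b]; first exact: itv_partition1.
by rewrite /= big_nat1.
Qed.

(* An interior corkscrew point: walk a distance [t] from a point close to [y] along
   the curve towards a point at distance at least [2 * t]. *)
Lemma uniform_corkscrew Omega : (0 < n)%N -> Omega !=set0 -> uniform_domain Omega ->
  exists2 sigma : R, 1 <= sigma & exists2 t0 : R, 0 < t0 &
  forall y t, boundary Omega y -> 0 < t <= t0 ->
  exists z, [/\ Omega z, eucl_norm (z - y) <= 2 * t &
    t / sigma <= eucl_dist (boundary Omega) z].
Proof.
move=> n0 [w Ow] [[oO _] [sigma s1 unif]]; exists sigma => //.
have s0 : 0 < sigma by rewrite (lt_le_trans _ s1).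
have [w' Ow' ww'] : exists2 w', Omega w' & 0 < eucl_norm (w - w').
  pose c (t : R) : 'rV[R]_n := w + t *: delta_mx ord0 (Ordinal n0).
  have cc : continuous c.
    by move=> t; apply: cvgD; [exact: cvg_cst|exact: scalel_continuous].
  have : nbhs (0 : R) (c @^-1` Omega).
    by apply: cc; rewrite /c scale0r addr0; exact: open_nbhs_nbhs.
  move=> /nbhs_ballP[e /= e0 eO].
  exists (c (e / 2)).
    apply: eO; rewrite /ball/= sub0r normrN gtr0_norm ?divr_gt0//.
    by rewrite ltr_pdivrMr// ltr_pMr// ltr1n.
  rewrite /c opprD addNKr eucl_normN eucl_normZ gtr0_norm ?divr_gt0//.
  rewrite mulr_gt0 ?divr_gt0//.
  apply: lt_le_trans (ler_coord_eucl _ (Ordinal n0)).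
  by rewrite mxE !eqxx normr1.
(* When [4 * t] is at most |w - w'|, one of [w] and [w'] is at distance at least [2 * t] from any
   given point. The curve towards it has length [l >= 2 * t], so the minimum of [t] and [l - t] is
   [t]. *)
exists (eucl_norm (w - w') / 4); first by rewrite divr_gt0.
move=> y t yB /andP[t0 tw].
have [x Ox xy] : exists2 x, Omega x & eucl_norm (x - y) < t.
  move: yB => [cy _].
  have [|x [Ox xy]] := cy (eucl_ball y t); last by exists x.
  apply: open_nbhs_nbhs; split; first exact: open_eucl_ball.
  exact: eucl_ball_center.
have [v Ov xv] : exists2 v, Omega v & 2 * t <= eucl_norm (x - v).
  have [xw|xw] := leP (2 * t) (eucl_norm (x - w)); first by exists w.
  exists w' => //; move: tw; rewrite ler_pdivlMr// => tw.
  have := ler_eucl_distD x w w'; rewrite (eucl_distC w x); lra.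
have [l [gamma [l0 gl [g0 g1] lv gd]]] := unif _ _ Ox Ov.
have xvl : eucl_norm (x - v) <= l.
  move: l0; rewrite le_eqVlt => /orP[/eqP l0|l0].
    by rewrite -g0 -g1 -l0 subrr eucl_norm0.
  by have := arc_length_chord gl (lexx 0) l0 (lexx l); rewrite g0 g1 subr0 eucl_distC.
have tl : 0 <= t <= l by apply/andP; split; lra.
have [Oz dz] := gd t tl.
exists (gamma t); split => //.
  rewrite (le_trans (ler_eucl_distD x _ _))// mulr_natl mulr2n lerD ?(ltW xy)//.
  by have := arc_length_chord gl (lexx 0) t0 (proj2 (andP tl)); rewrite g0 subr0.
rewrite (le_trans _ dz)// mulrC ler_wpM2l ?invr_ge0 ?(ltW s0)//.
by rewrite le_min lexx/=; lra.
Qed.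

End domains.

(** * Nets of Ahlfors regular sets *)

Section lebesgue_volume.
Variables (R : realType) (n : nat).
Implicit Types (x y z : 'rV[R]_n).

Lemma open_measurable_rV (U : set 'rV[R]_n) : open U -> measurable U.
Proof. by move=> oU; exact: sub_sigma_algebra. Qed.

Lemma closed_measurable_rV (U : set 'rV[R]_n) : closed U -> measurable U.
Proof.
move=> cU; rewrite -[U]setCK; apply: measurableC; apply: open_measurable_rV.
exact: closed_openC.
Qed.

Lemma continuous_measurable_rV (f : 'rV[R]_n -> R) : continuous f ->
  measurable_fun [set: 'rV[R]_n] f.
Proof.
move=> cf; apply: (measurability _ (RGenOpens.measurableE R)).
move=> _ [_ [a [b ->] <-]]; rewrite setTI; apply: open_measurable_rV.
by move/continuousP : cf; apply; exact: interval_open.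
Qed.

(** Cubes stand in for balls wherever a volume is computed, since a product measure evaluates them
    directly. *)
Definition cube z (t : R) : set 'rV[R]_n :=
  [set x | forall i, `|x ord0 i - z ord0 i| < t].

Let cubeE z t : cube z t = [set x | forall i,
  `](z ord0 i - t), (z ord0 i + t)[%classic (x ord0 i)].
Proof. by apply/seteqP; split => x xz i; have := xz i; rewrite /= in_itv/= -ltr_distl. Qed.

Lemma measurable_cube z t : measurable (cube z t).
Proof.
rewrite cubeE; apply: (measurable_box
  (A := fun i => `](z ord0 i - t), (z ord0 i + t)[%classic)) => i.
exact: measurable_itv.
Qed.

Lemma lebesgue_cube z t : 0 <= t -> lebesgue_rV R n (cube z t) = ((2 * t) ^+ n)%:E.
Proof.
move=> t0; rewrite cubeE (lebesgue_rV_box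
  (A := fun i => `](z ord0 i - t), (z ord0 i + t)[%classic)); last first.
  by move=> i; exact: measurable_itv.
transitivity (\prod_(i < n) (2 * t)%:E)%E.
  apply: eq_bigr => i _; rewrite lebesgue_measure_itv/= lte_fin.
  case: ltP => [_|]; first by rewrite -EFinB; congr EFin; ring.
  by move=> h; congr EFin; lra.
by rewrite prodEFin prodr_const card_ord.
Qed.

Lemma eucl_ball_sub_cube z t : eucl_ball z t `<=` cube z t.
Proof.
move=> x xz i; rewrite (le_lt_trans _ xz)//.
by have := ler_coord_eucl (x - z) i; rewrite !mxE.
Qed.

Lemma cube_sub_eucl_ball z t : (0 < n)%N -> cube z (t / n%:R) `<=` eucl_ball z t.
Proof.
move=> n0 x xz; rewrite /eucl_ball/=.
by apply: (@eucl_norm_cube _ _ (x - z) t n0) => i; rewrite !mxE; exact: xz.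
Qed.

Lemma measurable_eucl_ball z t : measurable (eucl_ball z t).
Proof. by apply: open_measurable_rV; exact: open_eucl_ball. Qed.

End lebesgue_volume.

Section finite_unions.
Context d (T : measurableType d) (R : realType) (mu : {measure set T -> \bar R}).
Variables (I : eqType) (B : I -> set T).
Hypothesis mB : forall k, measurable (B k).

Lemma measurable_seq_bigsetU (F : seq I) : measurable (\big[setU/set0]_(k <- F) B k).
Proof. exact: bigsetU_measurable. Qed.

Lemma measure_packing (F : seq I) (r : rel I) (c : R) : pairwise r F ->
  (forall k l, k \in F -> l \in F -> r k l -> B k `&` B l = set0) ->
  (forall k, k \in F -> (c%:E <= mu (B k))%E) ->
  (((size F)%:R * c)%:E <= mu (\big[setU/set0]_(k <- F) B k))%E.
Proof.
elim: F => [|k F IH] /=; first by rewrite mul0r measure_ge0.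
move=> /andP[rk rF] disj cB; rewrite big_cons measureU//.
- rewrite -add1n natrD mulrDl mul1r EFinD leeD//.
    by apply: cB; rewrite mem_head.
  apply: IH => // [l m lF mF|l lF]; [apply: disj|apply: cB];
    by rewrite in_cons ?lF ?mF orbT.
- exact: measurable_seq_bigsetU.
- rewrite big_distrr/= big_seq big1// => l lF; apply: disj.
  + by rewrite mem_head.
  + by rewrite in_cons lF orbT.
  + exact: (allP rk).
Qed.

Lemma measure_covering (F : seq I) (c : R) (X : set T) : measurable X ->
  X `<=` \big[setU/set0]_(k <- F) B k ->
  (forall k, k \in F -> (mu (B k) <= c%:E)%E) ->
  (mu X <= ((size F)%:R * c)%:E)%E.
Proof.
move=> mX XB Bc; apply: (@le_trans _ _ (mu (\big[setU/set0]_(k <- F) B k))).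
  by apply: le_measure => //; rewrite inE//; exact: measurable_seq_bigsetU.
elim: F Bc {XB} => [|k F IH] Bc; first by rewrite big_nil measure0 mul0r.
rewrite big_cons (le_trans (measureU2 _ _ _))//; first exact: measurable_seq_bigsetU.
rewrite /= -add1n natrD mulrDl mul1r EFinD leeD//.
  by apply: Bc; rewrite mem_head.
by apply: IH => l lF; apply: Bc; rewrite in_cons lF orbT.
Qed.

End finite_unions.

Section nets.
Variables (R : realType) (n : nat).
Implicit Types (x y : 'rV[R]_n) (E Gamma : set 'rV[R]_n) (F : seq 'rV[R]_n).

Definition separated (t : R) F :=
  pairwise (fun x y => t <= eucl_norm (x - y)) F.

(** A separated list of maximal size is a net: an uncovered point could be added to it. *)
Lemma maximal_separated E t N : 0 < t ->
  (forall F, (forall y, y \in F -> E y) -> separated t F -> (size F <= N)%N) ->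
  exists F, [/\ forall y, y \in F -> E y, separated t F &
    forall x, E x -> exists2 y, y \in F & eucl_norm (x - y) < t].
Proof.
move=> t0 bnd.
pose P m := `[< exists F, [/\ forall y, y \in F -> E y, separated t F & size F = m] >].
have P0 : exists m, P m by exists 0%N; apply/asboolP; exists [::].
have PN m : P m -> (m <= N)%N by move=> /asboolP[F [FE sF <-]]; exact: bnd.
case: (ex_maxnP P0 PN) => m /asboolP[F [FE sF Fm]] maxm.
exists F; split => // x Ex; apply: contrapT => H.
suff /maxm : P m.+1 by rewrite ltnn.
apply/asboolP; exists (x :: F); split; last by rewrite /= Fm.
  by move=> y; rewrite in_cons => /orP[/eqP ->//|/FE].
rewrite /separated /= -/(separated t F) sF andbT; apply/allP => y yF.
by rewrite leNgt; apply/negP => xy; apply: H; exists y.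
Qed.

Lemma separated_disjoint t x y : t <= eucl_norm (x - y) ->
  eucl_ball x (t / 2) `&` eucl_ball y (t / 2) = set0.
Proof.
move=> txy; apply/seteqP; split => // z [/= zx zy].
rewrite /eucl_ball/= in zx zy.
have := ler_eucl_distD z x y; rewrite (eucl_distC x z); lra.
Qed.

Lemma cover_bigsetU (I : choiceType) (F : seq I) (B : I -> set 'rV[R]_n) x k :
  k \in F -> B k x -> (\big[setU/set0]_(k <- F) B k) x.
Proof. by move=> kF Bx; rewrite -bigcup_seq; exists k. Qed.

(* The two mass bounds of a regular measure: disjoint balls around a separated set
   bound its size from above, the covering by a net bounds it from below. *)
Lemma ahlfors_net Gamma s x0 r0 : closed Gamma -> ahlfors_regular Gamma s ->
  Gamma x0 -> 0 < r0 ->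
  exists2 K : R, 0 < K & forall E t, E `<=` Gamma `&` eucl_ball x0 r0 -> 0 < t < r0 ->
  exists F, [/\ forall y, y \in F -> E y,
    separated t F,
    forall x, E x -> exists2 y, y \in F & eucl_norm (x - y) < t,
    (size F)%:R * t `^ s <= K &
    forall rho, 0 < rho < r0 -> Gamma `&` eucl_ball x0 rho `<=` E ->
      rho `^ s <= K * ((size F)%:R * t `^ s)].
Proof.
move=> cG [s0 [mu [_ _ mass]]] Gx0 r00.
have [a a0 {}mass] := mass x0 r0 Gx0 r00.
set A := Gamma `&` eucl_ball x0 r0 in mass *.
have mA : measurable A.
  by apply: measurableI; [exact: closed_measurable_rV|exact: measurable_eucl_ball].
have Ax0 : A x0 by split => //; exact: eucl_ball_center.
have muA : (mu A <= (a * r0 `^ s)%:E)%E.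
  have /andP[_] := mass x0 r0 Ax0 ltac:(by rewrite r00 ltr_pMl// ltr1n).
  by rewrite /A -setIA setIid.
have mAB y t : measurable (A `&` eucl_ball y t).
  by apply: measurableI => //; exact: measurable_eucl_ball.
(* The mass of [A] gives r0^s, the radius [t / 2] of the disjoint balls gives 2^s, and the two mass
   bounds cost a factor [a] each. *)
have pack F t : 0 < t < r0 -> (forall y, y \in F -> A y) -> separated t F ->
    (size F)%:R * t `^ s <= a ^+ 2 * (2 * r0) `^ s.
  move=> /andP[t0 tr0] FA sF.
  have : (((size F)%:R * (a^-1 * (t / 2) `^ s))%:E <= mu A)%E.
    apply: le_trans (measure_packing (mu := mu) (B := fun y => A `&` eucl_ball y (t / 2)) _ sF _ _) _.
    - by move=> y; exact: mAB.
    - move=> x y _ _ txy; rewrite setIACA setIid.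
      by rewrite (separated_disjoint txy) setI0.
    - move=> y yF; have ht : 0 < t / 2 < 2 * r0 by apply/andP; split; lra.
      by have /andP[] := mass y (t / 2) (FA _ yF) ht.
    - apply: le_measure; rewrite ?inE//.
        by apply: measurable_seq_bigsetU => y; exact: mAB.
      by rewrite -bigcup_seq => x [y _ []].
  move=> /le_trans/(_ muA); rewrite lee_fin => H.
  have -> : (size F)%:R * t `^ s =
      (size F)%:R * (a^-1 * (t / 2) `^ s) * a * 2 `^ s.
    have half2 : 2^-1 `^ s * 2 `^ s = 1 :> R.
      by rewrite -powRM ?invr_ge0// mulVf// powR1.
    rewrite powRM ?invr_ge0 ?(ltW t0)//.
    transitivity ((size F)%:R * t `^ s * (2^-1 `^ s * 2 `^ s)).
      by rewrite half2 mulr1.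
    by field; rewrite gt_eqF.
  rewrite [(2 * r0) `^ s]powRM ?(ltW r00)// [a ^+ 2]expr2.
  have -> : a * a * (2 `^ s * r0 `^ s) = a * r0 `^ s * a * 2 `^ s by ring.
  by rewrite ler_wpM2r ?powR_ge0// ler_wpM2r// ltW.
have s2r0 : 0 < (2 * r0) `^ s by rewrite powR_gt0// mulr_gt0.
(* One constant serves both estimates: packing needs a^2 (2 r0)^s, covering needs a^2. *)
exists (a ^+ 2 * (1 + (2 * r0) `^ s)); first by rewrite mulr_gt0 ?exprn_gt0// addr_gt0.
move=> E t EA tr0; have /andP[t0 _] := tr0.
have ts0 : 0 < t `^ s by rewrite powR_gt0.
have [F [FE sF cov]] : exists F, [/\ forall y, y \in F -> E y, separated t F &
    forall x, E x -> exists2 y, y \in F & eucl_norm (x - y) < t].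
  apply: (@maximal_separated _ _ (Num.truncn (a ^+ 2 * (2 * r0) `^ s / t `^ s))) => //.
  move=> F FE sF; rewrite -ltnS -(ltr_nat R).
  rewrite (le_lt_trans _ (truncnS_gt _))// ler_pdivlMr//.
  by apply: pack => // y /FE/EA.
exists F; split => //.
  rewrite (le_trans (pack F t tr0 _ sF))//; first by move=> y /FE/EA.
  by rewrite ler_pM2l ?exprn_gt0// lerDr.
move=> rho /andP[rho0 rhor0] GE.
have /andP[lb _] := mass x0 rho Ax0 ltac:(by apply/andP; split; lra).
have : (mu (A `&` eucl_ball x0 rho) <= ((size F)%:R * (a * t `^ s))%:E)%E.
  apply: (measure_covering (B := fun y => A `&` eucl_ball y t)).
  - by move=> y; exact: mAB.
  - exact: mAB.
  - move=> x [[Gx xr0] xrho]; have [y yF xy] := cov x (GE _ (conj Gx xrho)).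
    by apply: (cover_bigsetU yF); split.
  - move=> y yF; have ht : 0 < t < 2 * r0.
      by move/andP: tr0 => [? ?]; apply/andP; split; lra.
    by have /andP[] := mass y t (EA _ (FE _ yF)) ht.
move=> /(le_trans lb); rewrite lee_fin ler_pdivrMl// => /le_trans; apply.
rewrite (_ : a * ((size F)%:R * (a * t `^ s)) = a ^+ 2 * ((size F)%:R * t `^ s)); last by ring.
by rewrite ler_wpM2r ?mulr_ge0 ?powR_ge0// ler_peMr ?sqr_ge0// lerDl powR_ge0.
Qed.

End nets.

(** * Hausdorff dimension *)

Section hausdorff.
Variables (R : realType) (n : nat).
Implicit Types (x y : 'rV[R]_n) (A Gamma : set 'rV[R]_n).

Lemma powR_small (p c : R) : 0 < p -> 0 < c ->
  exists2 e, 0 < e & forall t, 0 <= t <= e -> t `^ p <= c.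
Proof.
move=> p0 c0; exists (c `^ p^-1); first exact: powR_gt0.
move=> t /andP[t0 te]; rewrite (@le_trans _ _ ((c `^ p^-1) `^ p))//.
  by apply: ge0_ler_powR => //; rewrite ?nnegrE ?powR_ge0// ltW.
by rewrite -powRrM mulVf ?gt_eqF// powRr1// ltW.
Qed.

Lemma eucl_diam_ge0 A : (0 <= eucl_diam A)%E.
Proof. by apply: ereal_sup_ubound; left. Qed.

Lemma eucl_diam_ball y t : 0 <= t -> (eucl_diam (eucl_ball y t) <= (2 * t)%:E)%E.
Proof.
move=> t0; apply: ge_ereal_sup => _ [->|[[x z] /= [xy zy] <-]].
  by rewrite lee_fin mulr_ge0.
rewrite /eucl_ball/= in xy zy.
rewrite lee_fin (le_trans (ler_eucl_distD y x z))// (eucl_distC y z).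
by rewrite mulr_natl mulr2n lerD// ltW.
Qed.

Lemma eucl_diam_set0 : eucl_diam (set0 : set 'rV[R]_n) = 0%E.
Proof.
apply/eqP; rewrite eq_le eucl_diam_ge0 andbT.
by apply: ge_ereal_sup => u [->|[[x z] []]].
Qed.

Lemma hausdorff_premeasure_ge0 t eps A : (0 <= hausdorff_premeasure t eps A)%E.
Proof.
apply: le_ereal_inf_tmp => _ [U _ <-].
by apply: nneseries_ge0 => k _ _; exact: poweR_ge0.
Qed.

Lemma nneseries_double (a : nat -> nat -> \bar R) (f : nat -> nat * nat) :
  bijective f -> (forall i j, (0 <= a i j)%E) ->
  (\sum_(k <oo) a (f k).1 (f k).2 = \sum_(i <oo) \sum_(j <oo) a i j)%E.
Proof.
move=> bf a0; rewrite nneseries_esumT//.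
transitivity (\esum_(k in [set: nat] `*`` (fun=> [set: nat])) a k.1 k.2)%E.
  have -> : [set: nat] `*`` (fun=> [set: nat]) = [set: nat * nat].
    by apply/seteqP; split.
  by rewrite (reindex_esum [set: nat] _ f)//; rewrite setTT_bijective.
rewrite -(@esum_esum _ _ _ _ _ a)// nneseries_esumT; last first.
  by move=> i; exact: nneseries_ge0.
by apply: eq_esum => i _; rewrite nneseries_esumT.
Qed.

Lemma hausdorff_premeasure_countable_cover (t eps e : R) A
    (F : nat -> seq 'rV[R]_n) (tau : nat -> R) : 0 < t -> 0 < eps -> 0 <= e ->
  (forall k, 0 <= 2 * tau k <= eps) ->
  (forall x, A x -> exists k, exists2 y, y \in F k & eucl_norm (x - y) < tau k) ->
  (forall k, (size (F k))%:R * (2 * tau k) `^ t <= e / (2 ^ k.+1)%:R) ->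
  (hausdorff_premeasure t eps A <= e%:E)%E.
Proof.
move=> t0 eps0 e0 tau_eps cov small.
have /card_set_bijP[f] : ([set: nat] #= [set: nat * nat])%card.
  by rewrite card_eq_sym; exact: card_nat2.
rewrite setTT_bijective => bf; have [g fK gK] := bf.
pose U p := if ((f p).2 < size (F (f p).1))%N
  then eucl_ball (nth 0 (F (f p).1) (f p).2) (tau (f p).1) else set0.
pose a i j := if (j < size (F i))%N then ((2 * tau i) `^ t)%:E else 0%E : \bar R.
have a0 i j : (0 <= a i j)%E by rewrite /a; case: ifPn => // _; rewrite lee_fin powR_ge0.
have tau0 k : 0 <= tau k by have /andP[] := tau_eps k; rewrite pmulr_rge0.
apply: (@le_trans _ _ (\sum_(p <oo) (eucl_diam (U p) `^ t))%E).
  apply: ereal_inf_lbound; exists U => //; split.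
    move=> x Ax; have [k [y yF xy]] := cov x Ax.
    exists (g (k, index y (F k))) => //.
    by rewrite /U gK/= index_mem yF nth_index.
  move=> p; rewrite /U; case: ifPn => _; last by rewrite eucl_diam_set0 lee_fin ltW.
  apply: le_trans (eucl_diam_ball _ (tau0 _)) _.
  by rewrite lee_fin; have /andP[] := tau_eps (f p).1.
apply: (@le_trans _ _ (\sum_(p <oo) a (f p).1 (f p).2)%E).
  apply: lee_nneseries => [p _ _|p _]; first exact: poweR_ge0.
  rewrite /U /a; case: ifPn => _.
    rewrite -poweR_EFin; apply: gt0_ler_poweR; rewrite ?(ltW t0)//.
    - by rewrite in_itv/= eucl_diam_ge0 leey.
    - by rewrite in_itv/= lee_fin mulr_ge0// leey.
    - exact: eucl_diam_ball.
  by rewrite eucl_diam_set0 poweR0r ?gt_eqF.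
rewrite nneseries_double//.
apply: le_trans (epsilon_trick0 xpredT e0).
apply: lee_nneseries => [i _ _|i _]; first exact: nneseries_ge0.
rewrite (nneseries_split 0 (size (F i))); last by move=> j _; exact: a0.
rewrite add0n [X in (_ + X)%E]eseries0 ?adde0; last first.
  by move=> j /= sj _; rewrite /a ltnNge sj.
rewrite (@le_trans _ _ (\sum_(0 <= j < size (F i)) ((2 * tau i) `^ t)%:E)%E)//.
  rewrite big_nat [leRHS]big_nat; apply: lee_sum => j /andP[_ ji].
  by rewrite /a ji.
by rewrite sumEFin lee_fin big_const_nat iter_addr_0 subn0 -[leLHS]mulr_natl.
Qed.

(** At exponent [s + e] a net of scale t in a bounded piece contributes O(t^-s t^(s + e)) = O(t^e).
    Each piece in the ball of radius [k + 1] thus has its own scale at which the contribution is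
    within its share. Both bounds together make the dimension a real number. *)
Lemma hausdorff_dim_le Gamma s : closed Gamma -> Gamma !=set0 ->
  ahlfors_regular Gamma s -> (0%E <= hausdorff_dim Gamma <= s%:E)%E.
Proof.
move=> cG [x0 Gx0] As; apply/andP; split.
  by apply: le_ereal_inf_tmp => _ [t [t0 _] <-]; rewrite lee_fin ltW.
have s0 : 0 < s by case: As.
apply/lee_addgt0Pr => e e0; apply: ereal_inf_lbound; exists (s + e) => //.
have t0 : 0 < s + e by rewrite addr_gt0.
split=> //; apply/eqP; rewrite eq_le; apply/andP; split; last first.
  apply: le_trans (hausdorff_premeasure_ge0 (s + e) 1 Gamma) _.
  by apply: ereal_sup_ubound; exists 1 => //=; exact: ltr01.
apply: ge_ereal_sup => _ [eps /= eps0 <-].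
apply/lee_addgt0Pr => c c0; rewrite add0e.
have /choice[Ft HFt] (k : nat) : exists Ft : seq 'rV[R]_n * R,
   [/\ 0 < 2 * Ft.2 <= eps,
     forall x, (Gamma `&` eucl_ball x0 k.+1%:R) x ->
       exists2 y, y \in Ft.1 & eucl_norm (x - y) < Ft.2 &
     (size Ft.1)%:R * (2 * Ft.2) `^ (s + e) <= c / (2 ^ k.+1)%:R].
  have k0 : 0 < k.+1%:R :> R by rewrite ltr0n.
  have [K K0 HK] := ahlfors_net cG As Gx0 k0.
  have ck : 0 < c / (2 ^ k.+1)%:R / (2 `^ (s + e) * K).
    by rewrite !divr_gt0 ?ltr0n ?expn_gt0// mulr_gt0// powR_gt0.
  have [t1 t10 Ht1] := powR_small e0 ck.
  (* The three entries make t^e small enough for the share of piece [k], keep the diameters at most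
     [eps], and keep [t] below the radius [k + 1]. *)
  pose t := Num.min t1 (Num.min (eps / 2) (k.+1%:R / 2)).
  have tt0 : 0 < t by rewrite !lt_min t10 !divr_gt0.
  have tk : 0 < t < k.+1%:R.
    rewrite tt0/= (@le_lt_trans _ _ (k.+1%:R / 2))//.
      by rewrite !ge_min lexx !orbT.
    by rewrite ltr_pdivrMr// ltr_pMr// ltr1n.
  have [F [_ _ cov sz _]] := HK (Gamma `&` eucl_ball x0 k.+1%:R) t (@subset_refl _ _) tk.
  exists (F, t); split => //=.
    rewrite mulr_gt0//= mulrC -ler_pdivlMr//.
    by rewrite !ge_min lexx !orbT.
  rewrite powRM ?(ltW tt0)// [t `^ (s + e)]powRD ?(gt_eqF tt0) ?implybT//.
  have te : t `^ e <= c / (2 ^ k.+1)%:R / (2 `^ (s + e) * K).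
    by apply: Ht1; rewrite (ltW tt0)/= !ge_min lexx.
  rewrite (_ : _ * _ = 2 `^ (s + e) * ((size F)%:R * t `^ s) * t `^ e); last by ring.
  apply: (@le_trans _ _ (2 `^ (s + e) * K * t `^ e)).
    by rewrite ler_wpM2r ?powR_ge0// ler_wpM2l ?powR_ge0.
  by rewrite mulrC -ler_pdivlMr// mulr_gt0// powR_gt0.
apply: (hausdorff_premeasure_countable_cover (F := fun k => (Ft k).1)
  (tau := fun k => (Ft k).2)) => //.
- exact: ltW.
- by move=> k; have [/andP[/ltW -> ->]] := HFt k.
- move=> x Gx; exists (Num.truncn (eucl_norm (x - x0))).
  have [_ cov _] := HFt (Num.truncn (eucl_norm (x - x0))); apply: cov; split => //.
  exact: truncnS_gt.
- by move=> k; have [] := HFt k.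
Qed.

End hausdorff.

(** * Volume of boundary layers *)

Section volumes.
Variables (R : realType) (n : nat) (s : R).
Implicit Types (x y z : 'rV[R]_n) (Gamma Omega : set 'rV[R]_n).

Lemma powR_natB (t : R) : 0 < t -> t `^ (n%:R - s) * t `^ s = t ^+ n.
Proof.
by move=> t0; rewrite -powRD ?(gt_eqF t0) ?implybT// subrK powR_mulrn// ltW.
Qed.

Lemma measurable_layer Gamma x0 (rho t : R) : Gamma !=set0 ->
  measurable (eucl_ball x0 rho `&` [set x | eucl_dist Gamma x < t]).
Proof.
move=> G0; apply: measurableI; first exact: measurable_eucl_ball.
apply: open_measurable_rV.
rewrite (_ : [set x | _] = eucl_dist Gamma @^-1` [set u | u < t])//.
by apply: open_comp; [move=> y _; exact: continuous_eucl_dist|exact: open_lt].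
Qed.

(** A point of the layer is within [t] of the boundary, hence within [2 * t] of a net of scale [t];
    this leaves at most K t^-s cubes of volume (4 t)^n. The net is taken in the ball of radius 3 = 2
    + 1, as [t <= 1]. *)
Lemma layer_volume_le Gamma x0 : closed Gamma -> ahlfors_regular Gamma s ->
  Gamma x0 -> exists2 C : R, 0 < C & forall t, 0 < t <= 1 ->
  (lebesgue_rV R n (eucl_ball x0 2 `&` [set x | eucl_dist Gamma x < t]%R)
    <= (C * t `^ (n%:R - s))%:E)%E.
Proof.
move=> cG As Gx0; have G0 : Gamma !=set0 by exists x0.
have [K K0 HK] := ahlfors_net (r0 := 8) cG As Gx0 ltac:(by []).
exists (K * 4 ^+ n); first by rewrite mulr_gt0// exprn_gt0.
move=> t /andP[t0 t1].
have EA : Gamma `&` eucl_ball x0 3 `<=` Gamma `&` eucl_ball x0 8.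
  move=> y [Gy y3]; split => //; rewrite /eucl_ball/= in y3 *.
  by rewrite (lt_trans y3)// ltr_nat.
have t8 : 0 < t < 8 by rewrite t0 (le_lt_trans t1)// ltr1n.
have [F [FE _ cov sz _]] := HK _ t EA t8.
apply: (@le_trans _ _ ((size F)%:R * (2 * (2 * t)) ^+ n)%:E).
  apply: (measure_covering (B := fun y => cube y (2 * t))).
  - by move=> y; exact: measurable_cube.
  - exact: measurable_layer.
  - move=> x [/= x2 xt]; rewrite /eucl_ball/= in x2.
    have te : 0 < t - eucl_dist Gamma x by rewrite subr_gt0.
    have [y Gy] := eucl_dist_adherent x G0 te => xy0; have xy : eucl_norm (x - y) < t by lra.
    have [|k kF yk] := cov y.
      split => //; rewrite /eucl_ball/=.
      by have := ler_eucl_distD x y x0; rewrite (eucl_distC y x); lra.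
    apply: (cover_bigsetU kF); apply: eucl_ball_sub_cube; rewrite /eucl_ball/=.
    by have := ler_eucl_distD y x k; lra.
  - move=> y _; have /(lebesgue_cube y) e : 0 <= 2 * t by rewrite mulr_ge0// ltW.
    exact: (eq_ind_r (fun u => (u <= _)%E) (lexx _) e).
rewrite lee_fin -(ler_pM2r (powR_gt0 s t0)) -[leRHS]mulrA powR_natB//.
rewrite (_ : 2 * (2 * t) = 4 * t); last by ring.
rewrite exprMn mulrAC.
by rewrite -[leRHS]mulrA ler_wpM2r// mulr_ge0// exprn_ge0// ltW.
Qed.

(** The net has separation [8 * t], and the small cube at the corkscrew point of [y] stays within
    [3 * t] of [y], so the cubes are disjoint. The lower mass bound makes them at least of order
    t^-s in number. *)
Lemma inner_volume_ge Omega x0 : (0 < n)%N -> Omega !=set0 -> uniform_domain Omega ->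
  ahlfors_regular (boundary Omega) s -> boundary Omega x0 ->
  exists (c sigma t0 : R), [/\ 0 < c, 1 <= sigma, 0 < t0 &
  forall t, 0 < t <= t0 -> exists Q,
    [/\ measurable Q,
      forall x, Q x -> [/\ Omega x, eucl_norm (x - x0) < 1 / 2 &
        t / (2 * sigma) <= eucl_dist (boundary Omega) x <= 3 * t] &
      ((c * t `^ (n%:R - s))%:E <= lebesgue_rV R n Q)%E]].
Proof.
move=> n0 O0 uO As Gx0; have [[oO _] _] := uO.
have nn : 0 < n%:R :> R by rewrite ltr0n.
have G0 : boundary Omega !=set0 by exists x0.
have cG := @closed_boundary _ _ Omega.
have [K K0 HK] := ahlfors_net (r0 := 8) cG As Gx0 ltac:(by []).
have [sigma s1 [t0 t00 corkscrew]] := uniform_corkscrew n0 O0 uO.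
have sg0 : 0 < sigma by rewrite (lt_le_trans _ s1).
have c0 : 0 < 4^-1 `^ s / K / (8 `^ s) / (sigma * n%:R) ^+ n.
  by rewrite !divr_gt0 ?powR_gt0// ?exprn_gt0 ?mulr_gt0 ?invr_gt0.
(* The factor 4^-s / K / 8^s counts the net points in the ball of radius 1/4 at scale [8 * t];
   (sigma n)^-n is the volume of a cube divided by t^n. The bound 1/12 gives [3 * t <= 1 / 4], which
   keeps the cubes within 1/2 of [x0]. *)
exists (4^-1 `^ s / K / (8 `^ s) / (sigma * n%:R) ^+ n), sigma, (Num.min t0 (1 / 12)).
split => //; first by rewrite lt_min t00 divr_gt0.
move=> t; rewrite le_min => /andP[tp /andP[tt0 t12]].
have /choice[z Hz] y : exists z, boundary Omega y ->
    [/\ Omega z, eucl_norm (z - y) <= 2 * t & t / sigma <= eucl_dist (boundary Omega) z].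
  have [By|nBy] := pselect (boundary Omega y); last by exists 0.
  by have [|z Hz] := corkscrew y t By; [rewrite tp tt0|exists z].
have EA : boundary Omega `&` eucl_ball x0 4^-1 `<=` boundary Omega `&` eucl_ball x0 8.
  move=> y [Gy y3]; split => //; rewrite /eucl_ball/= in y3 *; lra.
have t8 : 0 < 8 * t < 8 by apply/andP; split; lra.
have [F [FE sF _ _ lb]] := HK _ (8 * t) EA t8.
have {}lb := lb 4^-1 ltac:(by apply/andP; split; lra) (@subset_refl _ _).
(* Half of the corkscrew distance: the ball of radius [e] around [z y] stays in [Omega], at distance
   at least [e] from the boundary. *)
pose e := t / (2 * sigma).
have e0 : 0 < e by rewrite divr_gt0// mulr_gt0.
have et : e <= t / 2.
  by rewrite /e invfM mulrA ler_piMr ?divr_ge0 ?(ltW tp)// invf_le1.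
have sige : t / sigma = 2 * e by rewrite /e; field; rewrite gt_eqF.
have cube_prop y x : y \in F -> cube (z y) (e / n%:R) x ->
    [/\ Omega x, eucl_norm (x - y) < 3 * t, eucl_norm (x - x0) < 1 / 2 &
        e <= eucl_dist (boundary Omega) x <= 3 * t].
  move=> yF /(cube_sub_eucl_ball n0); rewrite /eucl_ball/= => xz.
  have [Gy yx0] := FE _ yF; rewrite /eucl_ball/= in yx0.
  have [Oz zy dz] := Hz y Gy.
  have xy : eucl_norm (x - y) < 3 * t.
    by have := ler_eucl_distD (z y) x y; lra.
  split => //.
  - by apply: (eucl_ball_sub_domain oO Oz); lra.
  - by have := ler_eucl_distD y x x0; lra.
  - apply/andP; split; last by rewrite (le_trans (eucl_dist_le x Gy))// ltW.
    have := eucl_dist_lipschitz x (z y) G0; rewrite ler_norml => /andP[+ _]; lra.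
exists (\big[setU/set0]_(y <- F) cube (z y) (e / n%:R)); split.
- by apply: measurable_seq_bigsetU => y; exact: measurable_cube.
- by move=> x; rewrite -bigcup_seq => -[y /= yF] /(cube_prop _ _ yF)[].
apply: le_trans (measure_packing (mu := lebesgue_rV R n)
  (B := fun y => cube (z y) (e / n%:R)) (c := (2 * (e / n%:R)) ^+ n) _ sF _ _).
- rewrite lee_fin -(ler_pM2r (powR_gt0 s tp)) -[leLHS]mulrA powR_natB//.
  rewrite (_ : 2 * (e / n%:R) = t / (sigma * n%:R)); last first.
    by rewrite /e; field; rewrite !gt_eqF.
  rewrite expr_div_n.
  rewrite (_ : _ * t ^+ n = 4^-1 `^ s * (t ^+ n / ((sigma * n%:R) ^+ n * K * 8 `^ s))); last first.
    by field; rewrite !gt_eqF ?powR_gt0 ?exprn_gt0 ?mulr_gt0.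
  rewrite (_ : (size F)%:R * _ * _ = (K * ((size F)%:R * (8 * t) `^ s)) *
      (t ^+ n / ((sigma * n%:R) ^+ n * K * 8 `^ s))); last first.
    rewrite (powRM s (ltW (ltac:(by []) : 0 < 8 :> R)) (ltW tp)).
    by field; rewrite !gt_eqF ?powR_gt0 ?exprn_gt0 ?mulr_gt0.
  by rewrite ler_wpM2r// divr_ge0 ?exprn_ge0 ?(ltW tp)// !mulr_ge0 ?exprn_ge0 ?powR_ge0// ltW// mulr_gt0.
- by move=> y; exact: measurable_cube.
- move=> k l kF lF kl; apply/seteqP; split => // x [/(cube_prop _ _ kF)[_ xk _ _]].
  move=> /(cube_prop _ _ lF)[_ xl _ _].
  by have := ler_eucl_distD x k l; rewrite (eucl_distC k x); lra.
- move=> k _; have /(lebesgue_cube (z k)) e' : 0 <= e / n%:R by rewrite divr_ge0 ?ltW.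
  exact: (eq_ind_r (fun u => (_ <= u)%E) (lexx _) e').
Qed.

End volumes.

(** * The test function *)

Section sqr_pos_values.
Variable R : realType.
Implicit Types t : R.

Lemma sqr_pos_ge0 t : 0 <= sqr_pos t.
Proof. exact: sqr_ge0. Qed.

Lemma sqr_pos_le0 t : t <= 0 -> sqr_pos t = 0.
Proof. by move=> t0; rewrite /sqr_pos max_l// expr0n. Qed.

Lemma sqr_posE t : 0 <= t -> sqr_pos t = t ^+ 2.
Proof. by move=> t0; rewrite /sqr_pos max_r. Qed.

Lemma sqr_pos_le1 t : t <= 1 -> sqr_pos t <= 1.
Proof.
by rewrite /sqr_pos => t1; have [t0|t0] := leP t 0; rewrite ?expr0n ?ler01// expr_le1// ltW.
Qed.

End sqr_pos_values.

(* [u] plays the role of a smooth [ln d]; the test function is [d^-al] cut off to the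
   shells [-3 N <= ln d <= - N] of the unit ball around [x0], so slowly in the scale [ln d]
   that the cutoff costs only [O(1 / N)] relative to [d^-al]. *)
Section test_function.
Variables (R : realType) (n : nat) (Omega : set 'rV[R]_n) (x0 : 'rV[R]_n).
Variables (delta p al eta N : R) (u : 'rV[R]_n -> R) (g : 'rV[R]_n -> 'rV[R]_n).
Local Notation d := (eucl_dist (boundary Omega)).
Hypotheses (oO : open Omega) (G0 : boundary Omega !=set0).
Hypotheses (al0 : 0 < al) (alE : al = (p + delta - 2) / 2).
Hypotheses (eta0 : 0 < eta) (eta1 : eta <= 1) (N1 : 1 <= N).
Hypothesis u_cgrad : has_cgrad u g.
Hypothesis g_le : forall x, eucl_norm (g x) <= expR (- u x).
Hypothesis u_le : forall x, eucl_norm (x - x0) <= 2 ->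
  expR (u x) <= d x + expR (- (3 * N)) / 4.
Hypothesis u_ge : forall x, d x <= (1 + eta) * expR (u x).

Let N0 : 0 < N. Proof. exact: lt_le_trans N1. Qed.

(** The affine coordinate that maps the range from -3 N to -N of [u] onto [-1, 1]. *)
Definition log_shell x := (u x + 2 * N) / N.
Definition shell_cutoff x := sqr_pos (1 - log_shell x ^+ 2).
Definition ball_cutoff x := sqr_pos (1 - eucl_norm (x - x0) ^+ 2).
Definition dist_power x := expR (- al * u x).
Definition test_formula x := dist_power x * (shell_cutoff x * ball_cutoff x).
Definition test_core : set 'rV[R]_n :=
  [set x | eucl_norm (x - x0) <= 1 /\ - (3 * N) <= u x <= - N].

Let dshell x := (2 * Num.max 0 (1 - log_shell x ^+ 2) * (- 2 * log_shell x / N)) *: g x.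
Let dball x := (2 * Num.max 0 (1 - eucl_norm (x - x0) ^+ 2) * (- 2)) *: (x - x0).
Definition test_formula_grad x :=
  dist_power x *: (shell_cutoff x *: dball x + ball_cutoff x *: dshell x) +
  (shell_cutoff x * ball_cutoff x) *: (dist_power x *: (- al *: g x)).

Lemma has_cgrad_test_formula : has_cgrad test_formula test_formula_grad.
Proof.
have hv : has_cgrad log_shell (fun x => N^-1 *: g x).
  apply: eq_has_cgrad (has_cgrad_scale N^-1 (has_cgradD u_cgrad (has_cgrad_cst n (2 * N)))) => x.
    by rewrite mulrC.
  by rewrite addr0.
have hq : has_cgrad (fun x => 1 - log_shell x ^+ 2)
    (fun x => (- 2 * log_shell x / N) *: g x).
  apply: eq_has_cgrad (has_cgradD (has_cgrad_cst n 1) (has_cgrad_scale (- 1) (has_cgradM hv hv))) => x.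
    by rewrite mulN1r expr2.
  by rewrite add0r -scalerDl !scalerA; congr (_ *: _); ring.
have hs : has_cgrad shell_cutoff dshell.
  by apply: eq_has_cgrad (has_cgrad_sqr_pos hq) => // x; rewrite scalerA.
have hb : has_cgrad ball_cutoff dball.
  have hc := has_cgradD (has_cgrad_cst n 1) (has_cgrad_scale (- 1) (has_cgrad_sqr_dist x0)).
  apply: eq_has_cgrad (has_cgrad_sqr_pos hc) => x.
    by rewrite mulN1r.
  by rewrite mulN1r add0r !scalerA; congr (_ *: _); ring.
have he := has_cgrad_expR (has_cgrad_scale (- al) u_cgrad).
exact: has_cgradM he (has_cgradM hs hb).
Qed.

Lemma dist_power_gt0 x : 0 < dist_power x. Proof. exact: expR_gt0. Qed.

Lemma shell_cutoff_itv x : 0 <= shell_cutoff x <= 1.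
Proof. by rewrite sqr_pos_ge0 sqr_pos_le1// gerBl sqr_ge0. Qed.

Lemma ball_cutoff_itv x : 0 <= ball_cutoff x <= 1.
Proof. by rewrite sqr_pos_ge0 sqr_pos_le1// gerBl sqr_ge0. Qed.

Lemma test_formula_out x : ~ test_core x -> test_formula x = 0 /\ test_formula_grad x = 0.
Proof.
move=> Cx.
have [xb|xb] := leP (eucl_norm (x - x0)) 1; last first.
  have b0 : 1 - eucl_norm (x - x0) ^+ 2 <= 0.
    by rewrite subr_le0 -{1}(expr1n _ 2) ler_pXn2r ?nnegrE// ltW// (lt_trans _ xb).
  rewrite /test_formula /test_formula_grad /ball_cutoff /dball sqr_pos_le0// max_l//.
  by rewrite !mulr0 mul0r !scale0r !scaler0 !addr0 scaler0.
have v1 : 1 < log_shell x ^+ 2.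
  rewrite ltNge; apply/negP => v1; apply: Cx; split => //.
  have : `|log_shell x| <= 1.
    by rewrite -(@ler_pXn2r _ 2) ?nnegrE// expr1n real_normK ?num_real.
  rewrite ler_norml /log_shell ler_pdivlMr// ler_pdivrMr// => /andP[? ?].
  by apply/andP; split; lra.
have b0 : 1 - log_shell x ^+ 2 <= 0 by lra.
rewrite /test_formula /test_formula_grad /shell_cutoff /dshell sqr_pos_le0// max_l//.
by rewrite !(mulr0, mul0r) !scale0r !scaler0 !addr0 scaler0.
Qed.

(** On the core e^u is at least e^-(3 N), so the additive error in [u_le] is at most a quarter of
    e^u. *)
Lemma test_core_dist x : test_core x ->
  3 / 4 * expR (u x) <= d x <= 2 * expR (u x).
Proof.
move=> [x1 /andP[u3 uN]]; apply/andP; split.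
  have h1 : expR (- (3 * N)) <= expR (u x) by rewrite ler_expR.
  have h2 : eucl_norm (x - x0) <= 2 by lra.
  have h3 := u_le h2; lra.
by rewrite (le_trans (u_ge x))// ler_wpM2r ?expR_ge0// -lerBrDl (le_trans eta1)// lerBrDl.
Qed.

Lemma test_core_dist_gt0 x : test_core x -> 0 < d x.
Proof.
by move=> /test_core_dist/andP[+ _]; apply: lt_le_trans; rewrite mulr_gt0 ?expR_gt0// divr_gt0.
Qed.

Definition hardy_weight x := d x `^ (delta / 2 - 1) * dist_power x.

(** The square is the exponential of (delta - 2) ln d - 2 al u. Since 2 al = p + delta - 2, this
    exponent is -p u plus (delta - 2) (ln d - u), and |ln d - u| <= 1 on the core because e >= 2. *)
Lemma hardy_weightE x : test_core x -> exists2 c, `|c| <= `|delta - 2| &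
  hardy_weight x ^+ 2 = expR (- p * u x + c).
Proof.
move=> Cx; have dx := test_core_dist_gt0 Cx.
exists ((delta - 2) * (ln (d x) - u x)).
  rewrite normrM ler_piMr// ler_norml; have /andP[d1 d2] := test_core_dist Cx.
  have e1 : 2 <= expR 1 :> R by rewrite (le_trans _ (expR_ge1Dx 1)).
  apply/andP; split.
    rewrite lerBrDl -ler_expR expRD lnK ?posrE// (le_trans _ d1)//.
    rewrite mulrC ler_wpM2r ?expR_ge0// expRN (@le_trans _ _ 2^-1)//; last by lra.
    by rewrite lef_pV2 ?posrE ?expR_gt0.
  rewrite lerBlDl -ler_expR expRD lnK ?posrE// (le_trans d2)//.
  by rewrite mulrC ler_wpM2l ?expR_ge0.
rewrite /hardy_weight /powR gt_eqF// -expRD -expRM_natl; congr expR.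
by rewrite alE; field.
Qed.

Lemma test_formula_le x : 0 <= test_formula x <= dist_power x.
Proof.
have /andP[s0 s1] := shell_cutoff_itv x; have /andP[b0 b1] := ball_cutoff_itv x.
rewrite /test_formula; apply/andP; split.
  by apply: mulr_ge0; [exact: expR_ge0|exact: mulr_ge0].
by apply: ler_piMr; [exact: expR_ge0|exact: mulr_ile1].
Qed.

Lemma test_formula_ge x : eucl_norm (x - x0) <= 1 / 2 -> `|u x + 2 * N| <= N / 2 ->
  dist_power x / 4 <= test_formula x.
Proof.
move=> xb uN; rewrite /test_formula ler_wpM2l ?expR_ge0//.
have b : 3 / 4 <= 1 - eucl_norm (x - x0) ^+ 2.
  have := eucl_norm_ge0 (x - x0); nra.
have v : 3 / 4 <= 1 - log_shell x ^+ 2.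
  have : `|log_shell x| <= 1 / 2.
    by rewrite normrM normfV (gtr0_norm N0) ler_pdivrMr//; lra.
  rewrite ler_norml => /andP[? ?]; nra.
rewrite /shell_cutoff /ball_cutoff !sqr_posE; [|lra|lra].
set a := 1 - _ in b *; set a' := 1 - _ in v *.
(* Each cutoff is at least (3/4)^2, and their product 81/256 exceeds 1/4. *)
have b2 : 9 / 16 <= a ^+ 2 by nra.
have v2 : 9 / 16 <= a' ^+ 2 by nra.
by apply: (@le_trans _ _ (9 / 16 * (9 / 16))); [lra|apply: ler_pM => //; lra].
Qed.

(** The bound d <= (1 + eta) e^u cancels |g| <= e^-u. The power then contributes [al] and the shell
    cutoff 4 / N; the ball cutoff has gradient at most 4, and e^u <= e^-N <= 1 / N turns it into
    another 4 / N. *)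
Lemma test_formula_grad_core x : test_core x ->
  d x * eucl_norm (test_formula_grad x) <=
  (1 + eta) * (al * test_formula x + 8 / N * dist_power x).
Proof.
move=> Cx; have [x1 /andP[u3 uN]] := Cx.
have /andP[s0 s1] := shell_cutoff_itv x; have /andP[b0 b1] := ball_cutoff_itv x.
have E0 := dist_power_gt0 x; have eu0 := expR_gt0 (u x).
have nb : eucl_norm (dball x) <= 4.
  rewrite eucl_normZ -[leRHS]mulr1; apply: ler_pM => //; rewrite ?eucl_norm_ge0//.
  have := sqr_ge0 (eucl_norm (x - x0)); have := eucl_norm_ge0 (x - x0).
  rewrite ler_norml; have [b|b] := leP 0 (1 - eucl_norm (x - x0) ^+ 2) => ? ?;
    by apply/andP; split; lra.
have v1 : `|log_shell x| <= 1.
  rewrite ler_norml /log_shell ler_pdivlMr// ler_pdivrMr//.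
  by apply/andP; split; lra.
have ns : eucl_norm (dshell x) <= 4 / N * expR (- u x).
  rewrite eucl_normZ; apply: ler_pM => //; first exact: eucl_norm_ge0.
  rewrite mulrA normrM normfV (gtr0_norm N0) ler_wpM2r ?invr_ge0 ?(ltW N0)// normrM.
  rewrite (_ : 4 = 2 * 2); last by ring.
  apply: ler_pM => //.
    have := sqr_ge0 (log_shell x).
    rewrite ler_norml; have [b|b] := leP 0 (1 - log_shell x ^+ 2) => ?;
      by apply/andP; split; lra.
  by move: v1; rewrite !ler_norml => /andP[? ?]; apply/andP; split; lra.
have ng : eucl_norm (test_formula_grad x) <=
    dist_power x * (4 + 4 / N * expR (- u x)) + al * test_formula x * expR (- u x).
  rewrite (le_trans (ler_eucl_normD _ _))// lerD//.
    rewrite eucl_normZ gtr0_norm// ler_wpM2l ?(ltW E0)//.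
    rewrite (le_trans (ler_eucl_normD _ _))// lerD// eucl_normZ ger0_norm//.
      by rewrite (le_trans _ nb)// ler_piMl// eucl_norm_ge0.
    by rewrite (le_trans _ ns)// ler_piMl// eucl_norm_ge0.
  rewrite !eucl_normZ normrN (gtr0_norm al0) (gtr0_norm E0).
  rewrite (ger0_norm (mulr_ge0 s0 b0)) /test_formula.
  rewrite (_ : shell_cutoff x * ball_cutoff x * (dist_power x * (al * eucl_norm (g x))) =
    al * (dist_power x * (shell_cutoff x * ball_cutoff x)) * eucl_norm (g x)); last by ring.
  apply: ler_wpM2l; last exact: g_le.
  by apply: mulr_ge0; [exact: ltW|apply: mulr_ge0; [exact: ltW|exact: mulr_ge0]].
have eN : expR (u x) <= N^-1.
  rewrite (@le_trans _ _ (expR (- N)))// ?ler_expR// expRN lef_pV2 ?posrE ?expR_gt0//.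
  by rewrite (le_trans _ (expR_ge1Dx N))// lerDr.
apply: (@le_trans _ _ (((1 + eta) * expR (u x)) *
    (dist_power x * (4 + 4 / N * expR (- u x)) + al * test_formula x * expR (- u x)))).
  by apply: ler_pM; rewrite ?eucl_dist_ge0 ?eucl_norm_ge0.
rewrite -mulrA ler_wpM2l ?addr_ge0 ?(ltW eta0)//.
have h : expR (u x) * (dist_power x * (4 + 4 / N * expR (- u x)) +
    al * test_formula x * expR (- u x)) =
    al * test_formula x + (4 * expR (u x) + 4 / N) * dist_power x.
  by rewrite expRN; field; rewrite !gt_eqF.
rewrite h lerD2l; apply: ler_wpM2r; first exact: ltW.
lra.
Qed.

(** Young's inequality (a + b)^2 <= (1 + eta) a^2 + (1 + 1 / eta) b^2 supplies the third factor 1 +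
    eta. In the remainder, 512 = 4 * 2 * 64 comes from (1 + eta)^2 <= 4, 1 + 1 / eta <= 2 / eta and
    the square of 8 / N. *)
Lemma test_formula_energy x : test_core x ->
  (d x `^ (delta / 2) * eucl_norm (test_formula_grad x)) ^+ 2 <=
  (1 + eta) ^+ 3 * al ^+ 2 * (d x `^ (delta / 2 - 1) * test_formula x) ^+ 2 +
  512 / (eta * N ^+ 2) * hardy_weight x ^+ 2.
Proof.
move=> Cx; have dx := test_core_dist_gt0 Cx.
have := test_formula_grad_core Cx; set D := d x * _ => DG.
have D0 : 0 <= D by rewrite mulr_ge0 ?eucl_norm_ge0 ?ltW.
rewrite (_ : d x `^ (delta / 2) * _ = d x `^ (delta / 2 - 1) * D); last first.
  rewrite mulrA; congr (_ * _); rewrite -[X in _ = _ * X](powRr1 (ltW dx)).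
  by rewrite -powRD ?subrK// (gt_eqF dx) implybT.
rewrite /hardy_weight [(_ * D) ^+ 2]exprMn [(_ * test_formula x) ^+ 2]exprMn.
rewrite [(_ * dist_power x) ^+ 2]exprMn.
set W := (d x `^ _) ^+ 2; have W0 : 0 <= W by exact: sqr_ge0.
set T := test_formula x in DG *; set E := dist_power x in DG *.
have T0 : 0 <= T by have /andP[] := test_formula_le x.
have E0 : 0 < E by exact: dist_power_gt0.
apply: (@le_trans _ _ (W * ((1 + eta) ^+ 3 * al ^+ 2 * T ^+ 2 + 512 / (eta * N ^+ 2) * E ^+ 2))); last first.
  by rewrite le_eqVlt; apply/orP; left; apply/eqP; ring.
rewrite ler_wpM2l//.
apply: (@le_trans _ _ (((1 + eta) * (al * T + 8 / N * E)) ^+ 2)).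
  by rewrite ler_pXn2r ?nnegrE// (le_trans D0 DG).
have ab (a b : R) : (a + b) ^+ 2 <= (1 + eta) * a ^+ 2 + (1 + eta^-1) * b ^+ 2.
  rewrite -subr_ge0 (_ : _ - _ = (eta * a - b) ^+ 2 / eta); last by field; rewrite gt_eqF.
  by rewrite divr_ge0 ?sqr_ge0 ?ltW.
rewrite exprMn; apply: (le_trans (ler_wpM2l (sqr_ge0 _) (ab _ _))).
rewrite mulrDr; apply: lerD.
  by rewrite le_eqVlt; apply/orP; left; apply/eqP; ring.
set Z := (8 / N * E) ^+ 2; have Z0 : 0 <= Z by exact: sqr_ge0.
have -> : 512 / (eta * N ^+ 2) * E ^+ 2 = 4 * (2 / eta) * Z.
  by rewrite /Z; field; rewrite !gt_eqF.
rewrite [leLHS]mulrA; apply: ler_wpM2r => //.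
apply: ler_pM; rewrite ?sqr_ge0//.
- by rewrite addr_ge0// invr_ge0 ltW.
- rewrite (_ : 4 = 2 ^+ 2); last by ring.
  rewrite ler_pXn2r ?nnegrE ?addr_ge0 ?(ltW eta0)//.
  by rewrite -lerBrDl (le_trans eta1)// lerBrDl.
- have : 1 <= eta^-1 by rewrite invf_ge1.
  by lra.
Qed.

Definition test_fun x := \1_Omega x * test_formula x.

(** Stated through [d] with closed conditions, so that it survives the closure of the support; the
    positive lower bound on [d] then keeps this closure inside [Omega]. *)
Let cutoff_region : set 'rV[R]_n := [set x | eucl_norm (x - x0) <= 1] `&`
  [set x | 3 / 4 * expR (- (3 * N)) <= d x] `&` [set x | d x <= 2 * expR (- N)].

Let closed_cutoff_region : closed cutoff_region.
Proof.
have closed_pre (f : 'rV[R]_n -> R) (A : set R) : continuous f -> closed A ->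
    closed (f @^-1` A).
  by move=> cf cA; apply: closed_comp => // x _; exact: cf.
have cd := continuous_eucl_dist G0.
apply: closedI; first apply: closedI.
- exact: (closed_pre _ _ (@continuous_eucl_dist_pt _ _ x0) (@closed_le R 1)).
- exact: (closed_pre _ _ cd (@closed_ge R _)).
- exact: (closed_pre _ _ cd (@closed_le R _)).
Qed.

Let support_sub : Omega `&` [set x | test_formula x != 0] `<=` Omega `&` cutoff_region.
Proof.
move=> x [Ox /eqP Tx]; split => //.
have Cx : test_core x by apply: contrapT => /test_formula_out[].
have [x1 /andP[u3 uN]] := Cx; have /andP[d1 d2] := test_core_dist Cx.
split; [split|] => //=.
  by rewrite (le_trans _ d1)// ler_wpM2l// ler_expR.
by rewrite (le_trans d2)// ler_wpM2l// ler_expR.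
Qed.

Let closure_support : closure (Omega `&` [set x | test_formula x != 0]) `<=`
  Omega `&` cutoff_region.
Proof.
move=> x Sx.
have cx : cutoff_region x.
  rewrite ((closure_id _).1 closed_cutoff_region); apply: closure_subset Sx.
  by move=> y /support_sub[].
split => //; apply: (dist_boundary_in oO).
  by apply: closure_subset Sx => y [].
have [[_ /= h] _] := cx.
by apply: lt_le_trans h; rewrite mulr_gt0 ?expR_gt0// divr_gt0.
Qed.

Lemma has_cgrad_test_fun : has_cgrad test_fun (fun x => \1_Omega x *: test_formula_grad x).
Proof.
apply: has_cgrad_restrict => //; first exact: has_cgrad_test_formula.
by move=> x /closure_support[].
Qed.

(** On the support d <= 2 e^-N, which is below [r] because e^N >= N. *)
Lemma Cc1_test_fun r : 2 < r * N -> Cc1 (boundary_layer Omega r) test_fun.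
Proof.
move=> rN; have [df dfg cg] := has_cgrad_test_fun.
have supp : closure [set x | test_fun x != 0] `<=` Omega `&` cutoff_region.
  apply: (subset_trans _ closure_support); apply: closure_subset => x /=.
  rewrite /test_fun indicE; have [Ox|Ox] := boolP (x \in Omega).
    by rewrite mul1r => Tx; split => //; exact: set_mem.
  by rewrite mul0r eqxx.
split => //.
- move=> i; have -> : partial i test_fun = (fun x => (\1_Omega x *: test_formula_grad x) ord0 i).
    by apply/funext => x; rewrite -dfg mxE.
  exact: cg.
- apply: bounded_closed_compact; last exact: closed_closure.
  exists (1 + `|x0|); split; first exact: num_real.
  move=> M xM x /supp[_ [[/= x1 _] _]].
  rewrite ltW// (le_lt_trans _ xM)// -lerBlDr.
  by rewrite (le_trans (lerB_dist _ _))// (le_trans (norm_le_eucl_norm _)).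
- move=> x /supp[Ox [_ /= xN]]; split => //.
  rewrite (le_lt_trans xN)// expRN ltr_pdivrMr ?expR_gt0//.
  rewrite (lt_le_trans rN)// ler_wpM2l//; last first.
    by rewrite (le_trans _ (expR_ge1Dx N))// lerDr.
  by rewrite -(pmulr_lge0 _ N0); lra.
Qed.

Lemma grad_test_fun x : Omega x -> grad test_fun x = test_formula_grad x.
Proof.
by have [_ -> _] := has_cgrad_test_fun => Ox; rewrite indicE mem_set// scale1r.
Qed.

Lemma test_funE x : Omega x -> test_fun x = test_formula x.
Proof. by move=> Ox; rewrite /test_fun indicE mem_set// mul1r. Qed.

End test_function.

(** * A smooth substitute for the logarithm of the distance *)

Section log_distance.
Variables (R : realType) (n : nat).
Implicit Types (x : 'rV[R]_n) (Gamma : set 'rV[R]_n).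

(** The three [eps] come from an almost nearest boundary point, its neighbour in the net and the
    smoothing. For [x] within 2 of [x0] that boundary point is within 5 of [x0], so a net in the
    ball of radius 6 suffices. The other bound is global, as the net lies in [Gamma]. *)
Lemma smooth_log_dist Gamma s x0 (eta eps : R) : closed Gamma ->
  ahlfors_regular Gamma s -> Gamma x0 -> 0 < eta -> 0 < eps <= 1 ->
  exists (u : 'rV[R]_n -> R) (g : 'rV[R]_n -> 'rV[R]_n),
  [/\ has_cgrad u g, forall x, eucl_norm (g x) <= expR (- u x),
    forall x, eucl_norm (x - x0) <= 2 -> expR (u x) <= eucl_dist Gamma x + 3 * eps
  & forall x, eucl_dist Gamma x <= (1 + eta) * expR (u x)].
Proof.
move=> cG As Gx0 eta0 /andP[eps0 eps1]; have G0 : Gamma !=set0 by exists x0.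
have [K _ HK] := ahlfors_net (r0 := 8) cG As Gx0 ltac:(by []).
have EA : Gamma `&` eucl_ball x0 6 `<=` Gamma `&` eucl_ball x0 8.
  by move=> y [Gy y6]; split => //; rewrite /eucl_ball/= in y6 *; lra.
have eps8 : 0 < eps < 8 by apply/andP; split; lra.
have [F [FE _ cov _ _]] := HK _ eps EA eps8.
have F0 : F != [::].
  have [|y yF _] := cov x0; first by split => //; exact: eucl_ball_center.
  by case: F yF {FE cov}.
have [u [g [ug gu ule uge]]] := softmin_dist F0 eps0 eta0.
exists u, g; split => // x.
- move=> x2; have [y Gy xy] := eucl_dist_adherent x G0 eps0.
  have xd := eucl_dist_le x Gx0.
  have [|k kF yk] := cov y.
    split => //; rewrite /eucl_ball/=.
    by have := ler_eucl_distD x y x0; rewrite (eucl_distC y x); lra.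
  by have := ule x k kF; have := ler_eucl_distD y x k; lra.
- have [y yF xy] := uge x; rewrite (le_trans _ xy)//.
  by apply: eucl_dist_le; have [] := FE _ yF.
Qed.

End log_distance.

(** * Weighted norms as integrals *)

Section integrals.
Variables (R : realType) (n : nat).
Implicit Types (x : 'rV[R]_n) (Omega : set 'rV[R]_n).

Lemma L2norm_sqr Omega (f : 'rV[R]_n -> R) : L2norm Omega f =
  ((\int[lebesgue_rV R n]_x ((\1_Omega x * f x) ^+ 2)%:E) `^ 2^-1)%E.
Proof.
rewrite /L2norm unlock /Lnorm; congr (_ `^ _)%E; apply: eq_integral => x _.
rewrite [(EFin \o _) x]/= abse_EFin poweR_EFin powR_mulrn// real_normK ?num_real// patchE indicE.
by case: ifPn => _; rewrite ?mul1r ?mul0r.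
Qed.

Lemma measurable_grad_norm (psi w : 'rV[R]_n -> R) :
  (forall i, continuous (partial i psi)) -> measurable_fun setT w ->
  measurable_fun setT (fun x => eucl_norm (w x *: grad psi x)).
Proof.
move=> cpsi mw.
have ms : measurable_fun setT (fun x => \sum_(i < n) (w x * partial i psi x) ^+ 2).
  apply: measurable_sum => i; apply: measurable_funX; apply: measurable_funM => //.
  exact: continuous_measurable_rV.
have -> : (fun x => eucl_norm (w x *: grad psi x)) =
    Num.sqrt \o (fun x => \sum_(i < n) (w x * partial i psi x) ^+ 2).
  apply/funext => x /=; congr Num.sqrt; apply: eq_bigr => i _.
  by rewrite !mxE.
apply: measurableT_comp ms; apply: continuous_measurable_fun.
exact: sqrt_continuous.
Qed.

Lemma measurable_dist_power Gamma (c : R) : Gamma !=set0 ->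
  measurable_fun setT (fun x : 'rV[R]_n => eucl_dist Gamma x `^ c).
Proof.
move=> G0; apply: (measurableT_comp (f := fun t : R => t `^ c)).
  exact: measurable_powR.
by apply: continuous_measurable_rV; exact: continuous_eucl_dist.
Qed.

Lemma measurable_sqr_indic Omega (f : 'rV[R]_n -> R) : open Omega ->
  measurable_fun setT f -> measurable_fun setT (fun x => ((\1_Omega x * f x) ^+ 2)%:E).
Proof.
move=> oO mf; apply/measurable_EFinP; apply: measurable_funX.
apply: measurable_funM => //.
by apply: measurable_indic; exact: open_measurable_rV.
Qed.

Lemma integral_indicZ (A : set 'rV[R]_n) (c : R) : measurable A -> 0 <= c ->
  (\int[lebesgue_rV R n]_x (c * \1_A x)%:E = c%:E * lebesgue_rV R n A)%E.
Proof.
move=> mA c0; under eq_integral do rewrite EFinM.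
rewrite ge0_integralZl_EFin//; first by rewrite integral_indic// setIT.
by apply/measurable_EFinP; exact: measurable_indic.
Qed.

End integrals.

(** * Mass and energy of the test function *)

Section energy.
Variables (R : realType) (n : nat) (s : R).
Implicit Types (x : 'rV[R]_n) (Gamma Omega : set 'rV[R]_n).

(** Full nested layers instead of shells: overlaps are harmless for a majorant. The factor 3 leaves
    room above the 2 in d <= 2 e^u. *)
Definition dyadic_layer Gamma x0 (k : nat) : set 'rV[R]_n :=
  eucl_ball x0 2 `&` [set x | eucl_dist Gamma x < 3 * expR (- k%:R)].

Definition layer_sum Gamma x0 (p : R) (N : nat) x : R :=
  \sum_(N <= k < (3 * N).+1) expR (k%:R * p) * \1_(dyadic_layer Gamma x0 k) x.

Lemma measurable_dyadic_layer Gamma x0 k : Gamma !=set0 ->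
  measurable (dyadic_layer Gamma x0 k).
Proof. exact: measurable_layer. Qed.

Lemma measurable_layer_sum Gamma x0 p N : Gamma !=set0 ->
  measurable_fun setT (layer_sum Gamma x0 p N).
Proof.
move=> G0; apply: measurable_sum => k; apply: measurable_funM => //.
by apply: measurable_indic; exact: measurable_dyadic_layer.
Qed.

Lemma layer_sum_ge0 Gamma x0 p N x : 0 <= layer_sum Gamma x0 p N x.
Proof. by apply: sumr_ge0 => k _; rewrite mulr_ge0 ?expR_ge0. Qed.

Lemma expR_ge_nat (k : nat) : k.+1%:R <= expR k%:R :> R.
Proof. by rewrite (le_trans _ (expR_ge1Dx _))// -natr1 addrC. Qed.

(* each layer contributes [O(1)] since its volume is [O(e^(- k (n - s)))] *)
Lemma integral_layer_sum_le Gamma x0 : closed Gamma -> ahlfors_regular Gamma s ->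
  Gamma x0 -> exists2 C : R, 0 < C & forall N, (2 <= N)%N ->
  (\int[lebesgue_rV R n]_x (layer_sum Gamma x0 (n%:R - s) N x)%:E <= (C * N%:R)%:E)%E.
Proof.
move=> cG As Gx0; have G0 : Gamma !=set0 by exists x0.
have [C C0 HC] := layer_volume_le cG As Gx0.
set p := n%:R - s in HC *.
exists (3 * (C * 3 `^ p)); first by rewrite !mulr_gt0// powR_gt0.
move=> N N2.
have mk (k : nat) : measurable_fun setT
    (fun x => (expR (k%:R * p) * \1_(dyadic_layer Gamma x0 k) x)%:E).
  apply/measurable_EFinP; apply: measurable_funM => //.
  by apply: measurable_indic; exact: measurable_dyadic_layer.
under eq_integral do rewrite /layer_sum -sumEFin.
rewrite ge0_integral_sum//.
apply: (@le_trans _ _ (\sum_(N <= k < (3 * N).+1) (C * 3 `^ p)%:E)%E).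
  rewrite big_nat [leRHS]big_nat; apply: lee_sum => k /andP[Nk _].
  rewrite integral_indicZ ?expR_ge0//; last exact: measurable_dyadic_layer.
  (* From [k >= 2] follows e^k >= k + 1 >= 3, so the layer has width at most 1, the range of
     [layer_volume_le]. *)
  have k2 : (2 <= k)%N := leq_trans N2 Nk.
  have t1 : 0 < 3 * expR (- k%:R : R) <= 1.
    rewrite mulr_gt0 ?expR_gt0//= expRN ler_pdivrMr ?expR_gt0// mul1r.
    by rewrite (le_trans _ (expR_ge_nat k))// ler_nat.
  apply: le_trans (lee_wpmul2l _ (HC _ t1)) _; first by rewrite lee_fin expR_ge0.
  rewrite -EFinM lee_fin powRM ?expR_ge0// -expRM.
  have -> : expR (k%:R * p) * (C * (3 `^ p * expR (- k%:R * p))) =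
    C * 3 `^ p * (expR (k%:R * p) * expR (- k%:R * p)) by ring.
  by rewrite -expRD mulNr subrr expR0 mulr1.
rewrite sumEFin lee_fin big_const_nat iter_addr_0 -[leLHS]mulr_natl.
have -> : 3 * (C * 3 `^ p) * N%:R = 3 * N%:R * (C * 3 `^ p) by ring.
rewrite ler_wpM2r//; first by rewrite mulr_ge0 ?powR_ge0// ltW.
by rewrite -natrM ler_nat leq_subLR; lia.
Qed.

(** The single term with [k] the integer part of [- u] suffices: [x] lies in that layer, and -u
    differs from [k] by at most 1, which costs e^|p| for either sign of [p]. *)
Lemma layer_sum_ge Gamma x0 p c (N : nat) x u : eucl_norm (x - x0) <= 1 ->
  - (3 * N%:R) <= u <= - N%:R -> eucl_dist Gamma x <= 2 * expR u ->
  expR (- p * u + c) <= expR (`|p| + `|c|) * layer_sum Gamma x0 p N x.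
Proof.
move=> x1 /andP[u3 uN] du.
have u0 : 0 <= - u by rewrite lerNr oppr0 (le_trans uN)// oppr_le0.
have /andP[k1 k2] := truncn_itv u0; set k := Num.truncn (- u) in k1 k2.
have Nk : (N <= k < (3 * N).+1)%N.
  rewrite -ltnS -(ltr_nat R) ltnS -(ler_nat R) natrM.
  by apply/andP; split; [apply: le_lt_trans k2|apply: le_trans k1 _]; lra.
have kT : dyadic_layer Gamma x0 k x.
  split; rewrite /= /eucl_ball/=; first by rewrite (le_lt_trans x1)// ltr1n.
  rewrite (le_lt_trans du)//; apply: (@le_lt_trans _ _ (2 * expR (- k%:R))).
    by rewrite ler_wpM2l// ler_expR; lra.
  by rewrite ltr_pM2r ?expR_gt0// ltr_nat.
rewrite /layer_sum (bigD1_seq k)/= ?mem_index_iota ?iota_uniq//.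
rewrite indicE mem_set// mulr1 mulrDr ler_wpDr//.
  by rewrite mulr_ge0 ?expR_ge0// sumr_ge0// => i _; rewrite mulr_ge0 ?expR_ge0.
rewrite -expRD ler_expR addrAC lerD ?ler_norm// -lerBlDr.
have -> : - p * u - k%:R * p = p * (- u - k%:R) by ring.
rewrite (le_trans (ler_norm _))// normrM ler_piMr// ger0_norm; first by move: k2; rewrite -natr1; lra.
by rewrite subr_ge0.
Qed.

Variables (Omega : set 'rV[R]_n) (x0 : 'rV[R]_n) (delta al r : R).
Local Notation Gamma := (boundary Omega).
Local Notation leb := (lebesgue_rV R n).
Hypotheses (n0 : (0 < n)%N) (O0 : Omega !=set0) (uO : uniform_domain Omega).
Hypotheses (As : ahlfors_regular Gamma s) (Gx0 : Gamma x0).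
Hypotheses (al0 : 0 < al) (alE : al = (n%:R - s + delta - 2) / 2) (r0 : 0 < r).

(** The constants [C] and [c] precede [eta] and [N]: the cutoff error C / (eta N) can thus be made
    small against [M] after [eta] is fixed. *)
Lemma test_energy : exists C c : R, [/\ 0 < C, 0 < c & exists N0 : nat,
  forall (eta : R) (N : nat), 0 < eta <= 1 -> (N0 <= N)%N -> (0 < N)%N /\
  exists (psi : 'rV[R]_n -> R) (M : R), [/\ Cc1 (boundary_layer Omega r) psi, c <= M,
    (\int[leb]_x ((\1_Omega x * (eucl_dist Gamma x `^ (delta / 2 - 1) * psi x)) ^+ 2)%R%:E
      = M%:E)%E &
    (\int[leb]_x ((\1_Omega x *
        eucl_norm (eucl_dist Gamma x `^ (delta / 2) *: grad psi x)) ^+ 2)%R%:E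
      <= ((1 + eta) ^+ 3 * al ^+ 2 * M + C / (eta * N%:R))%:E)%E]].
Proof.
have [[oO _] _] := uO.
(* [K] hides the numeral [512], which unification would unfold *)
have [K K0 KE] : exists2 K : R, 0 < K & K = 512 by exists 512; rewrite ?ltr0n.
have G0 : Gamma !=set0 by exists x0.
have cG := @closed_boundary _ _ Omega.
have [C2 C20 HC2] := integral_layer_sum_le cG As Gx0.
have [cv [sigma [t0 [cv0 s1 t00 HQ]]]] := inner_volume_ge n0 O0 uO As Gx0.
set p := n%:R - s in HC2 HQ.
pose C1 := expR (`|p| + `|delta - 2|).
have C10 : 0 < C1 := expR_gt0 _.
(* On the inner set at scale t = e^-(2 N) the bounds t / (2 sigma) <= d <= 3 t give t / (4 sigma) <=
   e^u <= 4 t, hence |u + 2 N| <= L. *)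
pose L := ln (4 * sigma).
have sg0 : 0 < sigma := lt_le_trans ltr01 s1.
have sg4 : 1 <= 4 * sigma by rewrite mulr_ege1// ler1n.
have L0 : 0 <= L by rewrite ln_ge0.
exists (K * (C1 * C2)), (expR (- (`|p| * L + `|delta - 2|)) / 16 * cv); split.
- by rewrite !mulr_gt0.
- by apply: mulr_gt0 => //; apply: divr_gt0 => //; exact: expR_gt0.
(* The summands ensure in turn that layers have width at most 1, that the support lies in the layer
   of width [r], that [L <= N / 2] so the cutoffs are bounded below on the inner set, and that e^-(2
   N) <= t0. *)
exists (Num.truncn (2 + 3 / r + 2 * L + t0^-1)).+1 => eta N /andP[eta0 eta1] NN.
have Nge : 2 + 3 / r + 2 * L + t0^-1 <= N%:R.
  by rewrite (le_trans (ltW (truncnS_gt _)))// ler_nat.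
have r30 : 0 < 3 / r by rewrite divr_gt0.
have t0V : 0 < t0^-1 by rewrite invr_gt0.
have N2 : 2 <= N%:R :> R by lra.
have N2L : 2 * L <= N%:R by lra.
have Nr : 2 < r * N%:R.
  have : 3 / r <= N%:R by lra.
  by rewrite ler_pdivrMr// mulrC; lra.
have N2n : (2 <= N)%N by rewrite -(ler_nat R).
have N1 : 1 <= N%:R :> R by lra.
split; first exact: leq_trans N2n.
pose eps : R := expR (- (3 * N%:R)) / 12.
have eps01 : 0 < eps <= 1.
  rewrite divr_gt0 ?expR_gt0//= ler_pdivrMr// mul1r.
  by rewrite (@le_trans _ _ 1)// ?ler1n// expR_le1 oppr_le0 mulr_ge0// ltW// (lt_le_trans _ N1).
have [u [g [ug gu ule0 uge]]] := smooth_log_dist cG As Gx0 eta0 eps01.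
have ule x : eucl_norm (x - x0) <= 2 ->
    expR (u x) <= eucl_dist Gamma x + expR (- (3 * N%:R)) / 4.
  by move=> /ule0; rewrite /eps => h; apply: (le_trans h); lra.
pose T := test_formula x0 al N%:R u.
pose psi := test_fun Omega x0 al N%:R u.
pose core := test_core x0 N%:R u.
pose W := hardy_weight Omega delta al u.
have psiC : Cc1 (boundary_layer Omega r) psi.
  exact: (Cc1_test_fun al oO G0 eta1 N1 ug ule uge).
have [dpsi cpsi _ _] := psiC.
pose A x := (\1_Omega x * (eucl_dist Gamma x `^ (delta / 2 - 1) * psi x)) ^+ 2.
pose B x := (\1_Omega x * eucl_norm (eucl_dist Gamma x `^ (delta / 2) *: grad psi x)) ^+ 2.
have mA : measurable_fun setT (EFin \o A).
  apply: measurable_sqr_indic => //; apply: measurable_funM.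
    exact: measurable_dist_power.
  by apply: continuous_measurable_rV => x; exact: differentiable_continuous.
have mB : measurable_fun setT (EFin \o B).
  apply: measurable_sqr_indic => //; apply: measurable_grad_norm => //.
  exact: measurable_dist_power.
have A0 x : 0 <= A x by exact: sqr_ge0.
have B0 x : 0 <= B x by exact: sqr_ge0.
pose S x := C1 * layer_sum Gamma x0 p N x.
have mS : measurable_fun setT (EFin \o S).
  by apply/measurable_EFinP; apply: measurable_funM => //; exact: measurable_layer_sum.
have S0 x : 0 <= S x by rewrite mulr_ge0 ?layer_sum_ge0// ltW.
have intS : (\int[leb]_x (S x)%:E <= (C1 * (C2 * N%:R))%:E)%E.
  under eq_integral do rewrite EFinM.
  rewrite ge0_integralZl_EFin ?(ltW C10)//.
  - by rewrite EFinM lee_wpmul2l ?lee_fin ?(ltW C10)// HC2.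
  - by move=> x _; rewrite lee_fin layer_sum_ge0.
  - by apply/measurable_EFinP; exact: measurable_layer_sum.
have WS x : core x -> W x ^+ 2 <= S x.
  move=> Cx; have [c cd ->] := hardy_weightE alE eta1 ule uge Cx.
  have [x1 u31] := Cx; have /andP[_ d2] := test_core_dist eta1 ule uge Cx.
  apply: (le_trans (layer_sum_ge p c x1 u31 d2)).
  by rewrite ler_wpM2r ?layer_sum_ge0// ler_expR lerD2l.
have AE x : Omega x -> A x = (eucl_dist Gamma x `^ (delta / 2 - 1) * T x) ^+ 2.
  by move=> Ox; rewrite /A /psi test_funE// indicE mem_set// mul1r.
have AS x : A x <= S x.
  have [Ox|Ox] := boolP (x \in Omega); last first.
    by rewrite /A indicE (negbTE Ox) mul0r expr0n.
  rewrite (AE _ (set_mem Ox)); have [Cx|Cx] := pselect (core x); last first.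
    by rewrite /T (test_formula_out al g N1 Cx).1 mulr0 expr0n.
  apply: le_trans (WS x Cx).
  have /andP[T0 TE] := test_formula_le x0 al N%:R u x.
  have w0 : 0 <= eucl_dist Gamma x `^ (delta / 2 - 1) := powR_ge0 _ _.
  have wT0 := mulr_ge0 w0 T0.
  have wE0 := mulr_ge0 w0 (expR_ge0 (- al * u x)).
  by rewrite /W /hardy_weight ler_pXn2r// ler_wpM2l.
have BAS x : B x <= (1 + eta) ^+ 3 * al ^+ 2 * A x + K / (eta * N%:R ^+ 2) * S x.
  have k1 : 0 <= (1 + eta) ^+ 3 * al ^+ 2 by rewrite mulr_ge0 ?sqr_ge0// exprn_ge0// addr_ge0// ltW.
  have k2 : 0 <= K / (eta * N%:R ^+ 2).
    by apply: divr_ge0; [exact: ltW|apply: mulr_ge0; [exact: ltW|exact: sqr_ge0]].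
  have rhs0 : 0 <= (1 + eta) ^+ 3 * al ^+ 2 * A x + K / (eta * N%:R ^+ 2) * S x.
    by apply: addr_ge0; exact: mulr_ge0.
  have [Ox|Ox] := boolP (x \in Omega); last first.
    by rewrite {1}/B indicE (negbTE Ox) mul0r expr0n.
  rewrite {1}/B indicE Ox mul1r (grad_test_fun al oO G0 eta1 N1 ug ule uge (set_mem Ox)).
  have [Cx|Cx] := pselect (core x); last first.
    by rewrite (test_formula_out al g N1 Cx).2 scaler0 eucl_norm0 expr0n.
  rewrite eucl_normZ ger0_norm ?powR_ge0// (AE _ (set_mem Ox)).
  rewrite KE in k2 *; apply: (le_trans (test_formula_energy delta G0 al0 eta0 eta1 N1 gu ule uge Cx)).
  by rewrite lerD2l ler_wpM2l// WS.
have intA : (\int[leb]_x (A x)%:E <= (C1 * (C2 * N%:R))%:E)%E.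
  apply: le_trans intS; apply: ge0_le_integral => //.
  - by move=> x _; rewrite lee_fin.
  - by move=> x _; rewrite lee_fin.
have intA0 : (0 <= \int[leb]_x (A x)%:E)%E.
  by apply: integral_ge0 => x _; rewrite lee_fin.
have Afin : (\int[leb]_x (A x)%:E)%E \is a fin_num.
  by rewrite ge0_fin_numE// (le_lt_trans intA)// ltry.
pose M := fine (\int[leb]_x (A x)%:E)%E.
have AM : (\int[leb]_x (A x)%:E = M%:E)%E by rewrite fineK.
exists psi, M; split => //.
- pose t := expR (- (2 * N%:R)) : R.
  have N0 : 0 < N%:R :> R by lra.
  have tt0 : 0 < t <= t0.
    rewrite expR_gt0/= -[leRHS]invrK /t expRN lef_pV2 ?posrE ?expR_gt0//.
    rewrite (le_trans _ (expR_ge1Dx _))//; lra.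
  have [Q [mQ HQx Qvol]] := HQ t tt0.
  (* A pointwise lower bound for [A] on [Q]: 16 is the square of the 4 in [test_formula_ge], and
     e^(2 N p) cancels the factor t^p in the volume of [Q]. *)
  pose c4 := expR (- (`|p| * L + `|delta - 2|)) * expR (2 * N%:R * p) / 16.
  have c40 : 0 <= c4 by rewrite !mulr_ge0 ?expR_ge0.
  rewrite -lee_fin -AM.
  apply: (@le_trans _ _ (c4%:E * leb Q)%E).
    apply: le_trans (lee_wpmul2l _ Qvol); last by rewrite lee_fin.
    rewrite -EFinM lee_fin /t -expRM /c4.
    have -> : expR (- (`|p| * L + `|delta - 2|)) * expR (2 * N%:R * p) / 16 *
        (cv * expR (- (2 * N%:R) * p)) = expR (- (`|p| * L + `|delta - 2|)) / 16 * cv *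
        (expR (2 * N%:R * p) * expR (- (2 * N%:R) * p)) by ring.
    by rewrite -expRD mulNr subrr expR0 mulr1.
  rewrite -integral_indicZ//; apply: ge0_le_integral => //.
  + by move=> x _; rewrite lee_fin mulr_ge0.
  + by apply/measurable_EFinP; apply: measurable_funM.
  move=> x _; rewrite lee_fin indicE; have [/set_mem Qx|_] := boolP (x \in Q); last first.
    by rewrite mulr0.
  rewrite mulr1; have [Ox x12 /andP[d1 d2]] := HQx x Qx.
  have x2 : eucl_norm (x - x0) <= 2 by lra.
  have eu0 := expR_gt0 (u x).
  have uhi : u x + 2 * N%:R <= L.
    rewrite -ler_expR /L lnK ?posrE ?mulr_gt0// expRD.
    rewrite (_ : expR (2 * N%:R) = t^-1); last by rewrite /t expRN invrK.
    rewrite ler_pdivrMr ?expR_gt0// (@le_trans _ _ (4 * t))//; last first.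
      by rewrite ler_wpM2r ?expR_ge0// ler_peMr.
    have : expR (- (3 * N%:R)) <= t by rewrite ler_expR; lra.
    by have := ule x x2; have := expR_gt0 (- (2 * N%:R) : R); rewrite -/t; lra.
  have ulo : - L <= u x + 2 * N%:R.
    rewrite -ler_expR expRN /L lnK ?posrE ?mulr_gt0// expRD.
    rewrite (_ : expR (2 * N%:R) = t^-1); last by rewrite /t expRN invrK.
    rewrite ler_pdivlMr ?expR_gt0// mulrC.
    have e2 : 1 + eta <= 2 by rewrite -lerBrDl (le_trans eta1)// lerBrDl.
    have h : t / (2 * sigma) <= 2 * expR (u x).
      by rewrite (le_trans d1)// (le_trans (uge x))// ler_wpM2r// ltW.
    rewrite (_ : t / (4 * sigma) = t / (2 * sigma) / 2); last by field; rewrite gt_eqF.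
    by lra.
  have uL : `|u x + 2 * N%:R| <= L by rewrite ler_norml ulo uhi.
  have Cx : core x.
    by split; [lra|move: uL; rewrite ler_norml => /andP[? ?]; apply/andP; split; lra].
  have TE : dist_power al u x / 4 <= T x.
    apply: test_formula_ge => //; first by lra.
    by rewrite (le_trans uL)//; lra.
  rewrite (AE _ Ox).
  apply: (@le_trans _ _ (W x ^+ 2 / 16)); last first.
    rewrite (_ : W x ^+ 2 / 16 =
      (eucl_dist Gamma x `^ (delta / 2 - 1) * (dist_power al u x / 4)) ^+ 2); last first.
      by rewrite /W /hardy_weight; field.
    have w0 : 0 <= eucl_dist Gamma x `^ (delta / 2 - 1) := powR_ge0 _ _.
    have E0 : 0 <= dist_power al u x / 4 by rewrite divr_ge0 ?expR_ge0.
    have wT0 := mulr_ge0 w0 (le_trans E0 TE).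
    have wE0 := mulr_ge0 w0 E0.
    by rewrite ler_pXn2r// ler_wpM2l.
  rewrite ler_wpM2r//; have [c cd ->] := hardy_weightE alE eta1 ule uge Cx.
  rewrite -expRD ler_expR.
  have h1 : - (`|p| * L) <= - p * (u x + 2 * N%:R).
    rewrite lerNl -mulNr opprK (le_trans (ler_norm _))// normrM.
    by rewrite ler_wpM2l.
  have h2 : - `|delta - 2| <= c by move: cd; rewrite ler_norml => /andP[].
  have -> : - (`|p| * L + `|delta - 2|) + 2 * N%:R * p =
    - (`|p| * L) + (2 * N%:R * p - `|delta - 2|) by ring.
  have -> : - p * u x + c = - p * (u x + 2 * N%:R) + (2 * N%:R * p + c) by ring.
  by rewrite lerD// lerD2l.
- have k1 : 0 <= (1 + eta) ^+ 3 * al ^+ 2 by rewrite mulr_ge0 ?sqr_ge0// exprn_ge0// addr_ge0// ltW.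
  have N0 : 0 < N%:R :> R by lra.
  have k2 : 0 <= K / (eta * N%:R ^+ 2).
    by apply: divr_ge0; [exact: ltW|apply: mulr_ge0; [exact: ltW|exact: sqr_ge0]].
  apply: (@le_trans _ _ (\int[leb]_x (((1 + eta) ^+ 3 * al ^+ 2)%:E * (A x)%:E +
      (K / (eta * N%:R ^+ 2))%:E * (S x)%:E))%E).
    rewrite -[leLHS]/(\int[leb]_x (B x)%:E)%E.
    apply: ge0_le_integral => //.
    + by move=> x _; rewrite lee_fin.
    + apply: emeasurable_funD; apply: measurable_funeM => //.
    + by move=> x _; rewrite -!EFinM -EFinD lee_fin; exact: BAS.
  rewrite ge0_integralD//; last 4 first.
  + by move=> x _; rewrite -EFinM lee_fin mulr_ge0.
  + exact: measurable_funeM.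
  + by move=> x _; rewrite -EFinM lee_fin mulr_ge0.
  + exact: measurable_funeM.
  rewrite !ge0_integralZl_EFin//; last 2 first.
  + by move=> x _; rewrite lee_fin.
  + by move=> x _; rewrite lee_fin.
  rewrite AM -EFinM EFinD leeD2l//.
  apply: (le_trans (lee_wpmul2l _ intS)); first by rewrite lee_fin.
  rewrite -EFinM lee_fin le_eqVlt; apply/orP; left; apply/eqP.
  by field; rewrite !gt_eqF.
Qed.

End energy.

(** * Upper bound for the Hardy constant *)

Section hardy_constant.
Variables (R : realType) (n : nat) (s : R).
Implicit Types Omega : set 'rV[R]_n.

Lemma boundary_nonempty Omega : open Omega -> boundary Omega !=set0 ->
  (0 < n)%N /\ Omega !=set0.
Proof.
move=> oO [y]; rewrite boundary_open// => -[cy Oy].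
have [w [Ow _]] : Omega `&` setT !=set0 by apply: cy; exact: filterT.
split; last by exists w.
rewrite lt0n; apply/negP => /eqP n0; apply: Oy; rewrite (_ : y = w)//.
by apply/rowP => i; have := ltn_ord i; rewrite {2}n0.
Qed.

(** The square of [al + e] exceeds that of [al] by more than 2 al e. The choice of [eta] spends one
    [al * e], with 7 from (1 + eta)^3 <= 1 + 7 eta for eta <= 1; the choice of [N] spends the other
    on the cutoff error, as [M >= c]. *)
Lemma layer_hardy_constant_le Omega (delta al r : R) : uniform_domain Omega ->
  boundary Omega !=set0 -> ahlfors_regular (boundary Omega) s ->
  0 < al -> al = (n%:R - s + delta - 2) / 2 -> 0 < r ->
  (layer_hardy_constant Omega delta r <= al%:E)%E.
Proof.
move=> uO G0 As al0 alE r0; have [[oO _] _] := uO.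
have [n0 O0] := boundary_nonempty oO G0; have [x0 Gx0] := G0.
have [C [c [C0 c0 [N0 H]]]] := test_energy n0 O0 uO As Gx0 al0 alE r0.
apply/lee_addgt0Pr => e e0.
have ae0 : 0 < al * e by rewrite mulr_gt0.
pose eta := Num.min 1 (e / (7 * al)).
have eta0 : 0 < eta by rewrite lt_min ltr01 divr_gt0// mulr_gt0.
have eta1 : eta <= 1 by rewrite ge_min lexx.
have eta7 : 7 * al ^+ 2 * eta <= al * e.
  have : eta <= e / (7 * al) by rewrite ge_min lexx orbT.
  rewrite ler_pdivlMr ?mulr_gt0// => h.
  rewrite (_ : 7 * al ^+ 2 * eta = al * (eta * (7 * al))); last by ring.
  by rewrite ler_wpM2l// ltW.
pose N := maxn N0 (Num.truncn (C / (eta * (al * e * c)))).+1.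
have [Npos [psi [M [psiC cM AM BM]]]] := H eta N ltac:(by rewrite eta0 eta1) (leq_maxl _ _).
have M0 : 0 < M := lt_le_trans c0 cM.
have NR0 : 0 < N%:R :> R by rewrite ltr0n.
have small : C / (eta * N%:R) <= al * e * M.
  apply: (@le_trans _ _ (al * e * c)); last by rewrite ler_pM2l.
  rewrite ler_pdivrMr ?mulr_gt0// mulrA -ler_pdivrMl ?mulr_gt0//.
  rewrite mulrC [_ * eta]mulrC (le_trans (ltW (truncnS_gt _)))// ler_nat.
  exact: leq_maxr.
have energy : (1 + eta) ^+ 3 * al ^+ 2 * M + C / (eta * N%:R) <= (al + e) ^+ 2 * M.
  have cube : (1 + eta) ^+ 3 <= 1 + 7 * eta.
    rewrite -subr_ge0 (_ : _ - _ = eta * (1 - eta) * (4 + eta)); last by ring.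
    by rewrite !mulr_ge0 ?subr_ge0 ?addr_ge0// ltW.
  have h1 : (1 + eta) ^+ 3 * al ^+ 2 <= al ^+ 2 + al * e.
    apply: (le_trans (ler_wpM2r (sqr_ge0 al) cube)).
    rewrite mulrDl mul1r lerD2l (_ : 7 * eta * al ^+ 2 = 7 * al ^+ 2 * eta)//.
    by ring.
  apply: (le_trans (lerD (ler_wpM2r (ltW M0) h1) small)).
  rewrite -mulrDl ler_wpM2r ?(ltW M0)// -subr_ge0.
  by rewrite (_ : _ - _ = e ^+ 2) ?sqr_ge0//; ring.
have mass : weighted_norm Omega delta psi = (M `^ 2^-1)%:E.
  by rewrite /weighted_norm L2norm_sqr AM poweR_EFin.
have grad : (weighted_grad_norm Omega delta psi <= ((al + e) * M `^ 2^-1)%:E)%E.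
  rewrite /weighted_grad_norm L2norm_sqr.
  have -> : (al + e) * M `^ 2^-1 = ((al + e) ^+ 2 * M) `^ 2^-1.
    rewrite powRM ?sqr_ge0 ?(ltW M0)//; congr (_ * _).
    rewrite -powR_mulrn ?addr_ge0 ?ltW// -powRrM mulfV// powRr1// addr_ge0// ltW//.
  rewrite -poweR_EFin; apply: gt0_ler_poweR => //.
  - by rewrite in_itv/= integral_ge0 ?leey// => x _; rewrite lee_fin sqr_ge0.
  - by rewrite in_itv/= lee_fin leey andbT mulr_ge0 ?sqr_ge0// ltW.
  - by apply: (le_trans BM); rewrite lee_fin.
have Mh0 : 0 < M `^ 2^-1 by rewrite powR_gt0.
apply: (@le_trans _ _ (weighted_grad_norm Omega delta psi / weighted_norm Omega delta psi)%E).
  apply: ereal_inf_lbound; exists psi => //; split => // psi0.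
  move: AM; rewrite psi0 integral0_eq; last first.
    by move=> x _; rewrite /= !mulr0 expr0n.
  by move=> [M00]; move: M0; rewrite -M00 ltxx.
by rewrite mass inver gt_eqF// lee_pdivrMr// -EFinD -EFinM.
Qed.

End hardy_constant.

Theorem proposition6p4 (R : realType) (d : nat) (Omega : set 'rV[R]_d)
    (s delta r b : R) :
  uniform_domain Omega ->
  boundary Omega !=set0 ->
  ahlfors_regular (boundary Omega) s ->
  2 - (d%:R - s) < delta ->
  0 < r -> 0 < b ->
  (forall psi, Cc1 (boundary_layer Omega r) psi ->
    (b%:E * weighted_norm Omega delta psi
       <= weighted_grad_norm Omega delta psi)%E) ->
  (hardy_constant Omega delta
     <= (d%:R%:E - hausdorff_dim (boundary Omega) + delta%:E - 2%:E) / 2%:E)%E.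
Proof.
move=> uO G0 As sdelta _ _ _.
have /andP[dim0 dims] := hausdorff_dim_le (@closed_boundary _ _ Omega) G0 As.
pose al := (d%:R - s + delta - 2) / 2.
have al0 : 0 < al by rewrite divr_gt0//; lra.
apply: (@le_trans _ _ al%:E).
  apply: ge_ereal_sup => _ [t /= t0 <-].
  exact: (layer_hardy_constant_le uO G0 As al0 erefl t0).
(* The bounds 0 and [s] exclude infinite dimensions, leaving a comparison of real numbers that
   decreases in the dimension. *)
move: dim0 dims; case: (hausdorff_dim _) => [h| |] //.
rewrite !lee_fin => h0 hs.
rewrite inver pnatr_eq0/= -[leRHS]/((d%:R - h + delta - 2) / 2)%:E lee_fin.
by rewrite ler_wpM2r// !lerD2r lerD2l lerN2.
Qed.
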